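(* Let $d \ge 1$ be an integer and let $\mu, \nu \in \mathcal{P}_2(\mathbb{R}^d)$. Then the following are equivalent: (i) $\mu \le_c \nu$, that is, $\int f(x)\, \mu(dx) \le \int f(x)\, \nu(dx)$ for all convex functions $f \colon \mathbb{R}^d \to \mathbb{R}$; (ii) $\mathcal{W}_2^2(\nu,\rho) - \mathcal{W}_2^2(\mu,\rho) \le \int |x|^2 \, \nu(dx) - \int |x|^2 \, \mu(dx)$ for all $\rho \in \mathcal{P}_2(\mathbb{R}^d)$.
   Context: $|\cdot|$ denotes the Euclidean norm on $\mathbb{R}^d$, and $\mathcal{P}_2(\mathbb{R}^d)$ denotes the set of (Borel) probability measures on $\mathbb{R}^d$ with finite second moment, i.e. $\int |x|^2\,\mu(dx) < \infty$. For $\mu,\nu \in \mathcal{P}_2(\mathbb{R}^d)$, the Wasserstein-2 distance $\mathcal{W}_2(\mu,\nu) \ge 0$ is defined by $$\mathcal{W}_2^2(\mu,\nu) := \inf_{\pi \in \Pi(\mu,\nu)} \int |x-y|^2 \, \pi(dx,dy),$$ where $\Pi(\mu,\nu)$ is the set of all probability measures on $\mathbb{R}^d \times \mathbb{R}^d$ with marginals $\mu$ (first) and $\nu$ (second). Here $\mathcal{W}_2^2(\mu,\nu)$ means $(\mathcal{W}_2(\mu,\nu))^2$. Integrals of real-valued convex functions against measures in $\mathcal{P}_2(\mathbb{R}^d)$ are understood as values in $(-\infty,+\infty]$ (they are well defined since a convex function is bounded below by an affine function). *)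

(* Defs.v *)
From HB Require Import structures.
From mathcomp Require Import all_boot all_order all_algebra.
From mathcomp Require Import all_classical all_reals all_analysis.

Set Implicit Arguments.
Unset Strict Implicit.
Unset Printing Implicit Defensive.

Import Order.TTheory GRing.Theory Num.Theory.
Import numFieldNormedType.Exports.

Local Open Scope classical_set_scope.
Local Open Scope ring_scope.

(* R^d with its Borel sigma-algebra.  The topology of 'rV[R]_d is induced by
   the sup norm, which is equivalent to the Euclidean one.  The library's
   sigma-algebra on Rd R d * Rd R d is the product one, which is the Borel
   sigma-algebra of the product since R^d is second countable. *)
Definition Rd (R : realType) (d : nat) : Type :=
  g_sigma_algebraType (@open 'rV[R]_d).

HB.instance Definition _ (R : realType) (d : nat) := Measurable.on (Rd R d).

(* The library norm `|x| on 'rV[R]_d is the sup norm, hence this definition. *)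
Definition euclidean_norm (R : realType) (d : nat) (x : 'rV[R]_d) : R :=
  Num.sqrt (\sum_(i < d) x ord0 i ^+ 2).

Definition moment2 (R : realType) (d : nat) (mu : probability (Rd R d) R) :
    \bar R :=
  (\int[mu]_x (euclidean_norm x ^+ 2)%:E)%E.

Definition P2 (R : realType) (d : nat) (mu : probability (Rd R d) R) : Prop :=
  (moment2 mu < +oo)%E.

(* Measures take arbitrary values on non-measurable sets, so marginals are
   compared on measurable sets only. *)
Definition couplings (R : realType) (d : nat)
    (mu nu : probability (Rd R d) R) :
    set (probability (Rd R d * Rd R d)%type R) :=
  [set pi | forall A : set (Rd R d), measurable A ->
     pushforward pi fst A = mu A /\ pushforward pi snd A = nu A].

Definition transport_cost (R : realType) (d : nat)
    (pi : probability (Rd R d * Rd R d)%type R) : \bar R :=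
  (\int[pi]_z (euclidean_norm ((z.1 : 'rV[R]_d) - z.2) ^+ 2)%:E)%E.

(* Valued in [0, +oo]; finite as soon as mu and nu are in P2. *)
Definition W2 (R : realType) (d : nat) (mu nu : probability (Rd R d) R) :
    \bar R :=
  sqrte (ereal_inf (@transport_cost R d @` couplings mu nu)).

(* Convex functions R^d -> R are continuous, hence measurable, and their
   negative part is integrable against measures in P2, so that the integrals
   below never involve the form +oo - +oo. *)
Definition convex_order (R : realType) (d : nat)
    (mu nu : probability (Rd R d) R) : Prop :=
  forall f : 'rV[R]_d -> R, convex_function [set: 'rV[R]_d] f ->
    (\int[mu]_x (f x)%:E <= \int[nu]_x (f x)%:E)%E.

(* Main.v *)
Require Import Defs.
From HB Require Import structures.
From mathcomp Require Import all_boot all_order all_algebra.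
From mathcomp Require Import all_classical all_reals all_analysis.
From mathcomp Require Import measurable_realfun ring lra.
Import Order.TTheory GRing.Theory Num.Theory.
Import numFieldNormedType.Exports.
Set Implicit Arguments.
Unset Strict Implicit.
Unset Printing Implicit Defensive.

Local Open Scope classical_set_scope.
Local Open Scope ring_scope.

(** Expanding the square, the cost of a coupling pi of mu and rho is the sum of
    the two second moments minus twice the correlation, the integral of x.z
    against pi.  So the inequality on W2 says that, for every rho, the best
    correlation with rho is at least as large for nu as for mu.

    From the convex order to W2.  By Kantorovich duality the best correlation of
    nu and rho is the infimum, over convex f with conjugate f^*, of the sum of
    the integrals of f against nu and of f^* against rho, and that is monotone
    in nu.  The attainment of this infimum by couplings is proved here only up to
    small errors, by an entropic argument.  If rho has atoms v_i of mass p_i, a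
    coupling of nu and rho amounts to weights w_i(y) >= 0 of sum 1 whose integrals
    against nu are the p_i.  Minimising over phi the integral of
    ln (sum_i exp (y.v_i / tau - phi_i)) plus sum_i phi_i p_i
    ([dual_cost_minimizer]), the softmax weights at the minimiser have exactly
    these masses ([softmax_marginal]) and their correlation falls short of the
    optimal dual value by a multiple of tau only ([softmax_gap]).  The dual value
    is the integral of a maximum of affine functions, which the convex order
    compares between mu and nu ([semidiscrete_transport]).  For a
    general rho the space is first partitioned into finitely many cells, each of
    which is replaced by one point with a small error in mean square
    ([finite_quantization]); given the cell, y and z are then drawn
    independently ([glue_coupling]), and Young's inequality controls the error
    ([convex_order_coupling]).

    From W2 to the convex order.  Let f be a maximum of finitely many affine
    functions, S(x) the slope of a piece that is active at x, and rho the law of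
    S under mu.  The inequality y.z <= f(y) + f^*(z) holds for all couplings of
    nu and rho, and it is an equality along the coupling (x, S(x)) of mu and rho.
    Comparing best correlations, the terms f^* cancel and the integral of f
    against mu is at most that against nu ([max_affine_le_of_W2]).  Every convex
    function on R^d is the supremum of countably many affine ones
    ([convex_countable_sup]), hence an increasing limit of such f, and monotone
    convergence concludes ([integral_le_limit]). *)

(** * The Euclidean inner product and the Borel structure of R^d *)

Definition dotv (R : realType) (d : nat) (x y : 'rV[R]_d) : R :=
  \sum_(i < d) x ord0 i * y ord0 i.

Section dot_product.
Variables (R : realType) (d : nat).
Implicit Types x y z : 'rV[R]_d.

Lemma euclidean_norm_sqr x : euclidean_norm x ^+ 2 = dotv x x.
Proof.
rewrite /euclidean_norm sqr_sqrtr; first by apply: eq_bigr => i _; rewrite expr2.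
by apply: sumr_ge0 => i _; exact: sqr_ge0.
Qed.

Lemma dotvC x y : dotv x y = dotv y x.
Proof. by apply: eq_bigr => i _; rewrite mulrC. Qed.

Lemma dotvDl x y z : dotv (x + y) z = dotv x z + dotv y z.
Proof.
by rewrite /dotv -big_split; apply: eq_bigr => i _; rewrite mxE mulrDl.
Qed.

Lemma dotvDr x y z : dotv x (y + z) = dotv x y + dotv x z.
Proof. by rewrite dotvC dotvDl !(dotvC x). Qed.

Lemma dotvZl a x y : dotv (a *: x) y = a * dotv x y.
Proof. by rewrite /dotv mulr_sumr; apply: eq_bigr => i _; rewrite mxE mulrA. Qed.

Lemma dotvZr a x y : dotv x (a *: y) = a * dotv x y.
Proof. by rewrite dotvC dotvZl dotvC. Qed.

Lemma dotvNl x y : dotv (- x) y = - dotv x y.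
Proof. by rewrite -scaleN1r dotvZl mulN1r. Qed.

Lemma dotvBl x y z : dotv (x - y) z = dotv x z - dotv y z.
Proof. by rewrite dotvDl dotvNl. Qed.

Lemma dotvBr x y z : dotv x (y - z) = dotv x y - dotv x z.
Proof. by rewrite dotvC dotvBl !(dotvC x). Qed.

Lemma dotv_ge0 x : 0 <= dotv x x.
Proof. by apply: sumr_ge0 => i _; rewrite -expr2 sqr_ge0. Qed.

Lemma dotvB_sqr x y :
  dotv (x - y) (x - y) = dotv x x + dotv y y - 2 * dotv x y.
Proof. rewrite dotvBl !dotvBr (dotvC y x); ring. Qed.

Lemma dotv_young x y : `|dotv x y| <= dotv x x + dotv y y.
Proof.
rewrite /dotv -big_split/=; apply: (le_trans (ler_norm_sum _ _ _)).
apply: ler_sum => i _; rewrite ler_norml.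
by apply/andP; split; nra.
Qed.

(** The gap between the two sides is t^-1 |t x - y|^2. *)
Lemma dotvD_young (t : R) x y : 0 < t ->
  dotv (x + y) (x + y) <= (1 + t) * dotv x x + (1 + t^-1) * dotv y y.
Proof.
move=> t0; rewrite -subr_ge0.
have -> : (1 + t) * dotv x x + (1 + t^-1) * dotv y y - dotv (x + y) (x + y) =
          t^-1 * dotv (t *: x - y) (t *: x - y).
  rewrite dotvB_sqr !dotvZl !dotvZr dotvDl !dotvDr (dotvC y x).
  by field; rewrite gt_eqF.
by rewrite mulr_ge0 ?dotv_ge0// invr_ge0 ltW.
Qed.

(** Bridge between the sup norm, which carries the topology, and the
    Euclidean norm, which carries the cost. *)
Lemma dotv_le_sup x (e : R) : `|x| <= e -> dotv x x <= d%:R * e ^+ 2.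
Proof.
move=> xe; have e0 : 0 <= e by exact: le_trans xe.
rewrite /dotv; apply: (@le_trans _ _ (\sum_(i < d) e ^+ 2)); last first.
  by rewrite sumr_const card_ord mulr_natl.
apply: ler_sum => i _.
have : `|x ord0 i| <= e.
  apply: le_trans xe; rewrite [in leRHS]/Num.norm/= mx_normrE.
  exact: (le_bigmax _ (fun k => `|x k.1 k.2|) (ord0, i)).
by rewrite ler_norml => /andP[? ?]; nra.
Qed.

End dot_product.

Section measurability.
Variables (R : realType) (d : nat).

Lemma Rd_open_measurable (A : set 'rV[R]_d) :
  open A -> measurable (A : set (Rd R d)).
Proof. by move=> oA; apply: sub_sigma_algebra. Qed.

Lemma measurable_coord (i : 'I_d) :
  measurable_fun setT (fun x : Rd R d => (x : 'rV[R]_d) ord0 i).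
Proof.
apply: (measurability _ (RGenOpens.measurableE R)) => _ [_ [a [b ->]] <-].
rewrite setTI; apply: Rd_open_measurable.
by apply: open_comp => [x _|]; [exact: coord_continuous|exact: interval_open].
Qed.

Lemma measurable_fun_dotv d' (T : measurableType d') (f g : T -> Rd R d) :
  measurable_fun setT f -> measurable_fun setT g ->
  measurable_fun setT (fun t => dotv (f t : 'rV[R]_d) (g t)).
Proof.
move=> mf mg; apply: measurable_sum => i; apply: measurable_funM.
  by apply: (measurableT_comp (measurable_coord i)).
by apply: (measurableT_comp (measurable_coord i)).
Qed.

Lemma measurable_fun_dotvB d' (T : measurableType d') (f g : T -> Rd R d) :
  measurable_fun setT f -> measurable_fun setT g ->
  measurable_fun setT (fun t => dotv ((f t : 'rV[R]_d) - g t)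
                                     ((f t : 'rV[R]_d) - g t)).
Proof.
move=> mf mg; under eq_fun do rewrite dotvB_sqr.
apply: measurable_funB; first apply: measurable_funD.
- exact: measurable_fun_dotv.
- exact: measurable_fun_dotv.
- by apply: measurable_funM => //; exact: measurable_fun_dotv.
Qed.

Lemma measurable_Rd_set1 (v : 'rV[R]_d) : measurable ([set v] : set (Rd R d)).
Proof.
rewrite -[X in measurable X]setCK; apply: measurableC; apply: Rd_open_measurable.
rewrite openC; apply/accessible_closed_set1/hausdorff_accessible.
exact: norm_hausdorff.
Qed.

End measurability.

Lemma rV_dense_seq (R : realType) (d : nat) :
  exists q : nat -> 'rV[R]_d,
    forall x (e : R), 0 < e -> exists k, `|x - q k| < e.
Proof.
pose q k : 'rV[R]_d := if @unpickle 'rV[rat]_d k is Some r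
                       then map_mx ratr r else 0.
exists q => x e e0.
have h (i : 'I_d) : exists r : rat, `|x ord0 i - ratr r| < e.
  have lt : x ord0 i - e < x ord0 i + e by lra.
  have [r] := rat_in_itvoo lt.
  by rewrite in_itv/= => /andP[? ?]; exists r; rewrite ltr_norml; apply/andP; split; lra.
pose r : 'rV[rat]_d := \row_i projT1 (cid (h i)).
exists (pickle r); rewrite /q pickleK.
rewrite [in ltLHS]/Num.norm/= mx_normrE; apply: bigmax_lt => // -[k i] _ /=.
by rewrite !mxE (ord1 k); case: cid.
Qed.

(** * Integrals of real functions against a probability *)

Section real_integrals.
Context d (T : measurableType d) (R : realType) (P : probability T R).
Implicit Types f g : T -> R.

(** Integrals of real functions are handled as real numbers, so that field
    and order tactics apply; [EFin_Rintegral] is the way back to extended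
    reals. *)
Definition summable_fun f := P.-integrable setT (EFin \o f).

Lemma summable_measurable f : summable_fun f -> measurable_fun setT f.
Proof. by move=> /measurable_int /measurable_EFinP. Qed.

Lemma summable_cst k : summable_fun (fun=> k).
Proof. exact: finite_measure_integrable_cst. Qed.

Lemma summableD f g : summable_fun f -> summable_fun g ->
  summable_fun (fun x => f x + g x).
Proof. by move=> hf hg; have := integrableD measurableT hf hg. Qed.

Lemma summableB f g : summable_fun f -> summable_fun g ->
  summable_fun (fun x => f x - g x).
Proof. by move=> hf hg; have := integrableB measurableT hf hg. Qed.

Lemma summableZ k f : summable_fun f -> summable_fun (fun x => k * f x).
Proof. by move=> hf; have := integrableZl measurableT k hf. Qed.

Lemma summable_norm f : summable_fun f -> summable_fun (fun x => `|f x|).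
Proof. by move=> hf; have := integrable_norm hf. Qed.

Lemma summable_sum (I : Type) (s : seq I) (h : I -> T -> R) :
  (forall i, summable_fun (h i)) -> summable_fun (fun x => \sum_(i <- s) h i x).
Proof.
move=> hh; have := integrable_sum measurableT s (P := xpredT) (fun i _ => hh i).
by apply: eq_integrable => // x _ /=; rewrite sumEFin.
Qed.

Lemma summable_le f g : measurable_fun setT f -> (forall x, `|f x| <= g x) ->
  summable_fun g -> summable_fun f.
Proof.
move=> mf fg; apply: le_integrable => //; first exact/measurable_EFinP.
by move=> x _ /=; rewrite lee_fin (le_trans (fg x))// ler_norm.
Qed.

Lemma summable_ge0 f : measurable_fun setT f -> (forall x, 0 <= f x) ->
  (\int[P]_x (f x)%:E < +oo)%E -> summable_fun f.
Proof.
move=> mf f0 foo; apply/integrableP; split; first exact/measurable_EFinP.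
by under eq_integral do rewrite /= ger0_norm//.
Qed.

Lemma EFin_Rintegral f : summable_fun f ->
  ((\int[P]_x f x)%:E = \int[P]_x (f x)%:E)%E.
Proof. by move=> hf; rewrite fineK//; exact: integrable_fin_num. Qed.

Lemma Rint_cst k : \int[P]_x k = k.
Proof. by rewrite Rintegral_cst//= (_ : P setT = 1%E) ?mulr1//; exact: probability_setT. Qed.

Lemma RintD f g : summable_fun f -> summable_fun g ->
  \int[P]_x (f x + g x) = \int[P]_x f x + \int[P]_x g x.
Proof. by move=> *; rewrite RintegralD. Qed.

Lemma RintB f g : summable_fun f -> summable_fun g ->
  \int[P]_x (f x - g x) = \int[P]_x f x - \int[P]_x g x.
Proof. by move=> *; rewrite RintegralB. Qed.

Lemma RintZ k f : summable_fun f -> \int[P]_x (k * f x) = k * \int[P]_x f x.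
Proof. by move=> *; rewrite RintegralZl. Qed.

Lemma Rint_sum (I : Type) (s : seq I) (h : I -> T -> R) :
  (forall i, summable_fun (h i)) ->
  \int[P]_x (\sum_(i <- s) h i x) = \sum_(i <- s) \int[P]_x h i x.
Proof.
move=> hh; elim: s => [|i s ih].
  by under eq_Rintegral do rewrite big_nil; rewrite big_nil Rint_cst.
under eq_Rintegral do rewrite big_cons.
by rewrite big_cons RintD ?ih//; exact: summable_sum.
Qed.

Lemma Rint_le f g : summable_fun f -> summable_fun g ->
  (forall x, f x <= g x) -> \int[P]_x f x <= \int[P]_x g x.
Proof. by move=> *; apply: le_Rintegral. Qed.

End real_integrals.

(** * Softmax weights with prescribed masses *)

Section softmax_weights.
Context d (T : measurableType d) (R : realType) (P : probability T R).
Variables (n : nat) (i0 : 'I_n) (g : 'I_n -> T -> R) (p : 'I_n -> R).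
Hypothesis gint : forall i, summable_fun P (g i).
Hypothesis p_gt0 : forall i, 0 < p i.
Hypothesis p_sum1 : \sum_i p i = 1.
Implicit Types (phi psi : 'rV[R]_n) (t : T) (i j : 'I_n).

Definition partition_fun phi t := \sum_i expR (g i t - phi ord0 i).

Definition softmax phi i t := expR (g i t - phi ord0 i) / partition_fun phi t.

(** The dual functional of the entropic optimal transport problem between P
    and the masses p, with potential phi on the atoms. *)
Definition dual_cost phi :=
  \int[P]_t ln (partition_fun phi t) + \sum_i phi ord0 i * p i.

Lemma partition_fun_ge phi t i : expR (g i t - phi ord0 i) <= partition_fun phi t.
Proof.
rewrite /partition_fun (bigD1 i)//= lerDl.
by apply: sumr_ge0 => k _; exact: expR_ge0.
Qed.

Lemma partition_fun_gt0 phi t : 0 < partition_fun phi t.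
Proof. by apply: lt_le_trans (partition_fun_ge phi t i0); exact: expR_gt0. Qed.

Lemma measurable_partition_fun phi : measurable_fun setT (partition_fun phi).
Proof.
apply: measurable_sum => i; apply: measurableT_comp => //.
by apply: measurable_funB => //; exact: summable_measurable (gint i).
Qed.

Lemma measurable_softmax phi i : measurable_fun setT (softmax phi i).
Proof.
have -> : softmax phi i = fun t =>
    expR (g i t - phi ord0 i - ln (partition_fun phi t)).
  apply/funext => t; rewrite expRD expRN lnK//.
  by rewrite posrE partition_fun_gt0.
apply: measurableT_comp => //; apply: measurable_funB.
  by apply: measurable_funB => //; exact: summable_measurable (gint i).
by apply: measurableT_comp => //; exact: measurable_partition_fun.
Qed.

Lemma softmax_gt0 phi i t : 0 < softmax phi i t.
Proof. by rewrite divr_gt0 ?expR_gt0 ?partition_fun_gt0. Qed.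

Lemma softmax_sum1 phi t : \sum_i softmax phi i t = 1.
Proof. by rewrite -mulr_suml mulfV// gt_eqF// partition_fun_gt0. Qed.

Lemma softmax_le1 phi i t : softmax phi i t <= 1.
Proof. by rewrite ler_pdivrMr ?partition_fun_gt0// mul1r partition_fun_ge. Qed.

Lemma summable_softmaxM phi i f :
  summable_fun P f -> summable_fun P (fun t => softmax phi i t * f t).
Proof.
move=> hf; apply: (summable_le (g := fun t => `|f t|)).
- by apply: measurable_funM; [exact: measurable_softmax|exact: summable_measurable hf].
- move=> t; rewrite normrM ger0_norm ?(ltW (softmax_gt0 _ _ _))//.
  by rewrite ler_piMl// softmax_le1.
- exact: summable_norm.
Qed.

Lemma summable_softmax phi i : summable_fun P (softmax phi i).
Proof.
have := summable_softmaxM phi i (summable_cst P 1).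
by under eq_fun do rewrite mulr1.
Qed.

Lemma ln_partition_ge phi t i : g i t - phi ord0 i <= ln (partition_fun phi t).
Proof.
by rewrite -ler_expR lnK ?posrE ?partition_fun_gt0// partition_fun_ge.
Qed.

Lemma ln_partition_lip phi psi (e : R) t :
  (forall i, psi ord0 i - e <= phi ord0 i) ->
  ln (partition_fun phi t) <= ln (partition_fun psi t) + e.
Proof.
move=> h; rewrite -ler_expR expRD !lnK ?posrE ?partition_fun_gt0//.
rewrite /partition_fun mulr_suml; apply: ler_sum => i _.
by rewrite -expRD ler_expR; have := h i; lra.
Qed.

Lemma summable_ln_partition phi :
  summable_fun P (fun t => ln (partition_fun phi t)).
Proof.
pose G t := \sum_i `|g i t|.
have gG i t : `|g i t| <= G t.
  rewrite /G (bigD1 i)//= lerDl; exact: sumr_ge0.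
pose K := \sum_i `|phi ord0 i|.
have phiK i : `|phi ord0 i| <= K.
  rewrite /K (bigD1 i)//= lerDl; exact: sumr_ge0.
have K0 : 0 <= K by exact: sumr_ge0.
apply: (summable_le (g := fun t => G t + (K + n%:R))).
- by apply: measurableT_comp => //; exact: measurable_partition_fun.
- move=> t; rewrite ler_norml; apply/andP; split.
    apply: le_trans (ln_partition_ge phi t i0).
    have := gG i0 t; have := phiK i0; rewrite !ler_norml.
    move=> /andP[_ ?] /andP[? _]; have : 0 <= n%:R :> R by []. lra.
  rewrite -ler_expR lnK ?posrE ?partition_fun_gt0//.
  apply: (@le_trans _ _ (\sum_(i < n) expR (G t + K))).
    apply: ler_sum => i _; rewrite ler_expR; have := gG i t; have := phiK i.
    by rewrite !ler_norml => /andP[? ?] /andP[? ?]; lra.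
  rewrite sumr_const card_ord addrA (expRD (G t + K)) -[leLHS]mulr_natr ler_wpM2l ?expR_ge0//.
  by apply: le_trans (expR_ge1Dx _); lra.
- apply: summableD; last exact: summable_cst.
  by apply: summable_sum => i; exact: summable_norm.
Qed.

Lemma dual_cost_lip phi psi : `|dual_cost phi - dual_cost psi| <= 2 * `|phi - psi|.
Proof.
have coord (v : 'rV[R]_n) i : `|v ord0 i| <= `|v|.
  rewrite [in leRHS]/Num.norm/= mx_normrE.
  exact: (le_bigmax _ (fun k => `|v k.1 k.2|) (ord0, i)).
(* By symmetry, the absolute value may be dropped. *)
suff h (u v : 'rV[R]_n) : dual_cost u - dual_cost v <= 2 * `|u - v|.
  by rewrite ler_norml h andbT lerNl opprB distrC h.
have {coord} : forall i, `|u ord0 i - v ord0 i| <= `|u - v|.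
  by move=> i; have := coord (u - v) i; rewrite !mxE.
move: (`|u - v|) => N uvN.
have {}uvN i : u ord0 i - v ord0 i <= N /\ v ord0 i - u ord0 i <= N.
  by have := uvN i; rewrite ler_norml => /andP[? ?]; split; lra.
have h2 : \sum_i u ord0 i * p i <= \sum_i v ord0 i * p i + N.
  rewrite -[X in _ <= _ + X]mulr1 -p_sum1 mulr_sumr -big_split/=.
  apply: ler_sum => i _; rewrite -mulrDl ler_wpM2r ?(ltW (p_gt0 i))//.
  by have [? ?] := uvN i; lra.
have h1 : \int[P]_t ln (partition_fun u t) <=
          \int[P]_t ln (partition_fun v t) + N.
  rewrite -[X in _ <= _ + X](Rint_cst P).
  rewrite -RintD; [|exact: summable_ln_partition|exact: summable_cst].
  apply: Rint_le; first exact: summable_ln_partition.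
    by apply: summableD; [exact: summable_ln_partition|exact: summable_cst].
  move=> t; apply: ln_partition_lip => i.
  by have [? ?] := uvN i; lra.
rewrite [leRHS]mulr_natl mulr2n /dual_cost opprD addrACA.
by apply: lerD; rewrite lerBlDl.
Qed.

Lemma dual_cost_shift phi c : dual_cost (phi + const_mx c) = dual_cost phi.
Proof.
have e t : ln (partition_fun (phi + const_mx c) t) = ln (partition_fun phi t) - c.
  apply: expR_inj; rewrite expRD !lnK ?posrE ?partition_fun_gt0//.
  rewrite /partition_fun mulr_suml; apply: eq_bigr => i _.
  by rewrite !mxE -expRD opprD addrA.
rewrite /dual_cost; under eq_Rintegral do rewrite e.
rewrite RintB; [|exact: summable_ln_partition|exact: summable_cst].
rewrite Rint_cst.
under eq_bigr do rewrite !mxE mulrDl.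
by rewrite big_split/= -mulr_sumr p_sum1; ring.
Qed.

(** The functional is Lipschitz, and it is coercive once phi is normalised to
    have minimum 0, because all p_i are positive; it is invariant under adding a
    constant to phi ([dual_cost_shift]), so a minimiser on a large box is a
    global one. *)
Lemma dual_cost_minimizer : exists phi, forall psi, dual_cost phi <= dual_cost psi.
Proof.
pose G t := \sum_i `|g i t|.
have gG i t : `|g i t| <= G t.
  rewrite /G (bigD1 i)//= lerDl; exact: sumr_ge0.
have Gint : summable_fun P G.
  by apply: summable_sum => i; exact: summable_norm.
pose A := dual_cost 0 + \int[P]_t G t.
(* The size K of the box satisfies K p_i >= A for every i, so that for a
   potential of minimum 0 outside the box the functional is at least its value
   at the potential 0. *)
pose K := `|A| * \sum_i (p i)^-1.
have pK i : A <= K * p i.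
  apply: (le_trans (ler_norm _)); rewrite /K -mulrA ler_peMr//.
  rewrite (bigD1 i)//= mulrDl mulVf ?gt_eqF// lerDl.
  rewrite mulr_ge0 ?(ltW (p_gt0 _))// sumr_ge0// => k _.
  by rewrite invr_ge0 ltW.
have K0 : 0 <= K.
  by rewrite mulr_ge0// sumr_ge0// => k _; rewrite invr_ge0 ltW.
pose B : set 'rV[R]_n := [set v | forall i, v ord0 i \in `[0, K]].
have cB : compact B.
  by apply: (@rV_compact _ _ (fun=> `[0, K]%classic)) => _; exact: segment_compact.
have B0 : B 0 by move=> i; rewrite mxE in_itv/= lexx.
have cF : {within B, continuous dual_cost}.
  apply: continuous_subspaceT => v.
  have fv : Filter (nbhs v) := nbhs_filter v.
  apply/cvgrPdist_lt => e e0.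
  have : nbhs v (ball v (2^-1 * e)) by apply: nbhsx_ballx; rewrite mulr_gt0.
  apply: filterS => u; rewrite -ball_normE /= => vu.
  by apply: (le_lt_trans (dual_cost_lip _ _)); rewrite -ltr_pdivlMl.
have [phi _ phimin] := EVT_min_rV (ex_intro _ _ B0) cB cF.
exists phi => psi.
have [j _ jmin] := @arg_minP _ _ _ i0 xpredT (fun i => psi ord0 i) isT.
(* The shift of psi whose minimum is 0. *)
pose u := psi - const_mx (psi ord0 j).
have -> : dual_cost psi = dual_cost u.
  by rewrite -[in LHS](subrK (const_mx (psi ord0 j)) psi) dual_cost_shift.
have u0 i : 0 <= u ord0 i by rewrite !mxE subr_ge0 jmin.
have uj : u ord0 j = 0 by rewrite !mxE subrr.
have [uB|] := pselect (B u); first by apply: phimin; rewrite inE.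
move=> /existsNP[i]; rewrite in_itv/= u0/= => /negP; rewrite -ltNge => Ku.
apply: (@le_trans _ _ (dual_cost 0)); first by apply: phimin; rewrite inE.
have : \int[P]_t (0 - G t) <= \int[P]_t ln (partition_fun u t).
  apply: Rint_le; first by apply: summableB => //; exact: summable_cst.
    exact: summable_ln_partition.
  move=> t; apply: le_trans (ln_partition_ge u t j).
  by have := gG j t; rewrite uj ler_norml => /andP[? ?]; lra.
rewrite RintB; [|exact: summable_cst|by[]]; rewrite Rint_cst => h1.
have : K * p i <= \sum_k u ord0 k * p k.
  rewrite (bigD1 i)//=; apply: (@le_trans _ _ (u ord0 i * p i)).
    by rewrite ler_wpM2r// ltW.
  by rewrite lerDl sumr_ge0// => k _; rewrite mulr_ge0// ltW.
by have := pK i; rewrite /A [dual_cost u]/dual_cost; lra.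
Qed.

(** Moving the single coordinate phi_j multiplies the partition function by an
    explicit factor; with ln (1 + x) <= x this replaces differentiation under
    the integral sign. *)
Lemma partition_fun_delta phi j s t :
  partition_fun (phi + s *: delta_mx ord0 j) t =
  partition_fun phi t * (1 + softmax phi j t * (expR (- s) - 1)).
Proof.
rewrite mulrDr mulr1 mulrA [partition_fun phi t * _]mulrC divfK; last first.
  by rewrite gt_eqF// partition_fun_gt0.
rewrite /partition_fun (bigD1 j)//= [X in _ = X + _](bigD1 j)//=.
rewrite !mxE !eqxx mulr1 opprD addrA (expRD _ (- s)).
under eq_bigr => i ij do rewrite !mxE (negbTE ij) andbF mulr0 addr0.
by ring.
Qed.

(** First order condition at the minimiser: moving phi_j by s gives
    0 <= m (exp (- s) - 1) + s p_j for all real s, where m is the mass of the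
    j-th weight, and the two signs of s force m = p_j. *)
Lemma softmax_marginal phi j : (forall psi, dual_cost phi <= dual_cost psi) ->
  \int[P]_t softmax phi j t = p j.
Proof.
move=> phimin; set m := \int[P]_t softmax phi j t.
have m0 : 0 <= m.
  by apply: Rintegral_ge0 => t _; rewrite ltW// softmax_gt0.
have key s : 0 <= m * (expR (- s) - 1) + s * p j.
  have := phimin (phi + s *: delta_mx ord0 j); rewrite /dual_cost.
  have -> : \sum_i (phi + s *: delta_mx ord0 j) ord0 i * p i =
      \sum_i phi ord0 i * p i + s * p j.
    rewrite (bigD1 j)//= [X in _ = X + _](bigD1 j)//=.
    under eq_bigr => i ij do rewrite !mxE (negbTE ij) andbF mulr0 addr0.
    by rewrite !mxE !eqxx/=; ring.
  have sW : summable_fun P (fun t => (expR (- s) - 1) * softmax phi j t).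
    by apply: summableZ; exact: summable_softmax.
  have : \int[P]_t ln (partition_fun (phi + s *: delta_mx ord0 j) t) <=
      \int[P]_t (ln (partition_fun phi t) + (expR (- s) - 1) * softmax phi j t).
    apply: Rint_le; first exact: summable_ln_partition.
      by apply: summableD => //; exact: summable_ln_partition.
    move=> t; rewrite partition_fun_delta.
    have w0 := softmax_gt0 phi j t; have w1 := softmax_le1 phi j t.
    have es : - 1 < softmax phi j t * (expR (- s) - 1).
      by have := expR_gt0 (- s); nra.
    rewrite lnM ?posrE ?partition_fun_gt0//; last by lra.
    by rewrite lerD2l [leRHS]mulrC; apply: le_ln1Dx.
  rewrite RintD; [|exact: summable_ln_partition|by[]].
  rewrite RintZ; last exact: summable_softmax.
  rewrite -/m; move: (\int[P]_t ln _) (\int[P]_t ln _) (\sum_i _) => X Y Z.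
  by lra.
(* Dividing the inequality by s and using elementary bounds on exp gives both
   comparisons up to a factor 1 - s. *)
have up (s : R) : 0 < s -> s < 1 -> m * (1 - s) <= p j.
  move=> s0 s1; have := key s.
  have h : expR (- s) - 1 <= - s * (1 - s).
    have : 1 + s <= expR s := expR_ge1Dx s.
    have : expR (- s) * expR s = 1 by rewrite -expRD addNr expR0.
    have := expR_gt0 (- s); nra.
  by nra.
have dn (s : R) : 0 < s -> s < 1 -> (1 - s) * p j <= m.
  move=> s0 s1; have := key (- s).
  have h : (expR (- - s) - 1) * (1 - s) <= s.
    rewrite opprK.
    have : 1 + - s <= expR (- s) := expR_ge1Dx (- s).
    have : expR (- s) * expR s = 1 by rewrite -expRD addNr expR0.
    have := expR_gt0 s; nra.
  by nra.
apply/eqP; rewrite eq_le; apply/andP; split; apply/ler_addgt0Pl => e e0.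
  pose s := Num.min (1 / 2) (e / (1 + m)).
  have s0 : 0 < s by rewrite lt_min; apply/andP; split => //; rewrite divr_gt0//; lra.
  have s1 : s < 1 by rewrite gt_min; apply/orP; left; lra.
  have sm : s * (1 + m) <= e by rewrite -ler_pdivlMr ?ge_min ?lexx ?orbT//; lra.
  have := up s s0 s1; nra.
pose s := Num.min (1 / 2) (e / (1 + p j)).
have s0 : 0 < s.
  by rewrite lt_min; apply/andP; split => //; rewrite divr_gt0//; have := p_gt0 j; lra.
have s1 : s < 1 by rewrite gt_min; apply/orP; left; lra.
have sm : s * (1 + p j) <= e.
  by rewrite -ler_pdivlMr ?ge_min ?lexx ?orbT//; have := p_gt0 j; lra.
have := dn s s0 s1; nra.
Qed.

(** An index i whose value a_i lies below a_j by t has weight at most exp (- t),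
    hence contributes at most t exp (- t) <= 1 to the average of a_j - a_i. *)
Lemma softmax_gap phi t j :
  g j t - phi ord0 j <=
  \sum_i softmax phi i t * (g i t - phi ord0 i) + n%:R.
Proof.
set a := fun i => g i t - phi ord0 i; rewrite -/(a j).
have h i : softmax phi i t * (a j - a i) <= 1.
  have [aij|aij] := leP (a j) (a i).
    by apply: (@le_trans _ _ 0) => //; have := softmax_gt0 phi i t; nra.
  have : softmax phi i t * expR (a j - a i) <= 1.
    rewrite mulrAC ler_pdivrMr ?partition_fun_gt0// mul1r -expRD -/(a i) addrC.
    by rewrite subrK; exact: partition_fun_ge.
  apply: le_trans; rewrite ler_wpM2l ?ltW ?softmax_gt0//.
  by have := expR_ge1Dx (a j - a i); lra.
have : \sum_i softmax phi i t * (a j - a i) <= \sum_(i < n) 1 by apply: ler_sum.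
rewrite sumr_const card_ord.
under eq_bigr do rewrite mulrBr.
by rewrite sumrB -mulr_suml softmax_sum1 mul1r; lra.
Qed.

End softmax_weights.

(** * Densities, couplings and discretisation *)

Section density.
Import HBNNSimple.
Context d (T : measurableType d) (R : realType) (P : probability T R).
Variable h : T -> R.
Hypothesis mh : measurable_fun setT h.
Hypothesis h_ge0 : forall t, 0 <= h t.
Hypothesis h_int1 : (\int[P]_t (h t)%:E = 1)%E.

Let density_set (A : set T) : \bar R := (\int[P]_(t in A) (h t)%:E)%E.

Let density0 : density_set set0 = 0%E.
Proof. exact: integral_set0. Qed.

Let density_ge0 A : (0 <= density_set A)%E.
Proof. by apply: integral_ge0 => t _; rewrite lee_fin. Qed.

Let density_sigma_additive : semi_sigma_additive density_set.
Proof.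
apply: semi_sigma_additive_nng_induced; first exact/measurable_EFinP.
by move=> t; rewrite lee_fin.
Qed.

(** The formula holds for simple functions by definition of the measure with
    density h, and passes to the limit by monotone convergence. *)
Lemma probability_density :
  exists Q : probability T R, forall f : T -> \bar R,
    measurable_fun setT f -> (forall t, 0 <= f t)%E ->
    (\int[Q]_t f t = \int[P]_t (f t * (h t)%:E))%E.
Proof.
pose mQ := isMeasure.Build _ _ _ density_set density0 density_ge0
  density_sigma_additive.
pose Q0 : {measure set T -> \bar R} := HB.pack density_set mQ.
pose pQ := Measure_isProbability.Build _ _ _ Q0 h_int1.
pose Q : probability T R := HB.pack (Measure.sort Q0) mQ pQ.
move: (Q) (fun A => erefl : Q A = (\int[P]_(t in A) (h t)%:E)%E) => {mQ Q0 pQ}{}Q QE.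
have meh : measurable_fun setT (EFin \o h) by exact/measurable_EFinP.
have h0 t : (0 <= (h t)%:E)%E by rewrite lee_fin.
exists Q => f mf f0.
pose f_ := nnsfun_approx measurableT mf.
have f_nd t : {homo (fun n => (f_ n t)%:E) : m n / (m <= n)%N >-> (m <= n)%E}.
  by move=> m n mn; rewrite lee_fin; exact/lefP/nd_nnsfun_approx.
have f_cvg t : (f_ n t)%:E @[n --> \oo] --> f t.
  by apply: cvg_nnsfun_approx => // x _; exact: f0.
have simple n : (\int[Q]_t (f_ n t)%:E = \int[P]_t ((f_ n t)%:E * (h t)%:E))%E.
  under eq_integral do rewrite fimfunE -fsumEFin//.
  rewrite ge0_integral_fsum//; last 2 first.
  - by move=> r; exact/measurable_EFinP/measurableT_comp.
  - by move=> r t _; rewrite EFinM nnfun_muleindic_ge0.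
  under [RHS]eq_integral => t _.
    rewrite fimfunE -fsumEFin// ge0_mule_fsuml; last first.
      by move=> r; rewrite EFinM nnfun_muleindic_ge0.
    over.
  rewrite [RHS]ge0_integral_fsum//; last 2 first.
  - move=> r; apply: emeasurable_funM => //.
    exact/measurable_EFinP/measurableT_comp.
  - by move=> r t _; rewrite mule_ge0// EFinM nnfun_muleindic_ge0.
  apply: eq_fsbigr => r rf.
  have r0 : (0 <= r)%R by move: rf; rewrite inE => -[t _ <-].
  have mB : measurable (f_ n @^-1` [set r]) by [].
  under eq_integral do rewrite EFinM.
  rewrite ge0_integralZl//; last exact/measurable_EFinP/measurable_indic.
  rewrite integral_indic// setIT.
  transitivity (r%:E * \int[P]_(t in f_ n @^-1` [set r]) (h t)%:E)%E.
    by congr (_ * _)%E; exact: QE.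
  under [RHS]eq_integral do rewrite EFinM -muleA.
  rewrite ge0_integralZl//; last 2 first.
  - apply: emeasurable_funM => //; exact/measurable_EFinP/measurable_indic.
  - by move=> t _; rewrite mule_ge0// lee_fin.
  congr (_ * _)%E; rewrite [LHS]integral_mkcond; congr integral.
  by apply/funext => t; rewrite patchE indicE; case: ifPn => _ /=; rewrite ?mul1e ?mul0e.
have lhs : (\int[Q]_t (f_ n t)%:E @[n --> \oo] --> \int[Q]_t f t)%E.
  rewrite (eq_integral (fun t => limn (fun n => (f_ n t)%:E))); last first.
    by move=> t _; apply/esym/cvg_lim => //; exact: f_cvg.
  apply: cvg_monotone_convergence => //.
  - by move=> n; exact/measurable_EFinP.
  - by move=> n t _; rewrite lee_fin.
have rhs : (\int[P]_t ((f_ n t)%:E * (h t)%:E) @[n --> \oo]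
            --> \int[P]_t (f t * (h t)%:E))%E.
  rewrite (eq_integral (fun t => limn (fun n => (f_ n t)%:E * (h t)%:E)%E)); last first.
    by move=> t _; apply/esym/cvg_lim => //; apply: cvgeZr => //; exact: f_cvg.
  apply: cvg_monotone_convergence => //.
  - by move=> n; apply: emeasurable_funM => //; exact/measurable_EFinP.
  - by move=> n t _; rewrite mule_ge0// lee_fin.
  - by move=> t _ m n mn; rewrite lee_wpmul2r//; exact: f_nd.
move: lhs; rewrite (funext simple) => lhs.
exact: (cvg_unique (@ereal_hausdorff R) lhs rhs).
Qed.

End density.

Section finite_partition.
Context d (T : measurableType d) (R : realType) (P : probability T R).
Variables (n : nat) (j : T -> 'I_n).
Hypothesis mj : forall i, measurable (j @^-1` [set i]).

Definition cell_mass i : R := fine (P (j @^-1` [set i])).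

Lemma EFin_cell_mass i : ((cell_mass i)%:E = P (j @^-1` [set i]))%E.
Proof. by rewrite fineK// fin_num_measure. Qed.

(** Functions of the cell are finite sums of indicators; all measurability and
    integration facts on cells come from this. *)
Lemma cell_expand (F : 'I_n -> R) t :
  F (j t) = \sum_i F i * \1_(j @^-1` [set i]) t.
Proof.
rewrite (bigD1 (j t))//= [X in _ = _ + X]big1 ?addr0; last first.
  by move=> i ij; rewrite indicE memNset ?mulr0//= => /esym/eqP; exact/negP.
by rewrite indicE mem_set// mulr1.
Qed.

Lemma summable_cell i : summable_fun P (\1_(j @^-1` [set i]) : T -> R).
Proof. exact: integrable_indic. Qed.

Lemma Rint_cell i : \int[P]_t \1_(j @^-1` [set i]) t = cell_mass i.
Proof. by rewrite /Rintegral integral_indic// setIT. Qed.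

Lemma summable_cells (F : 'I_n -> R) : summable_fun P (fun t => F (j t)).
Proof.
under eq_fun do rewrite cell_expand.
by apply: summable_sum => i; apply: summableZ; exact: summable_cell.
Qed.

Lemma measurable_cells d' (T' : measurableType d') (F : 'I_n -> T') :
  measurable_fun setT (fun t => F (j t)).
Proof.
move=> _ B mB; rewrite setTI.
rewrite (_ : _ @^-1` B = \bigcup_(i in [set i | B (F i)]) j @^-1` [set i]).
  by apply: fin_bigcup_measurable => // i _; exact: mj.
by apply/seteqP; split => [t Bt|t [i Bi /= ti]]; [exists (j t)|rewrite /= ti].
Qed.

Lemma Rint_cells (F : 'I_n -> R) :
  \int[P]_t F (j t) = \sum_i F i * cell_mass i.
Proof.
under eq_Rintegral do rewrite cell_expand.
rewrite Rint_sum; last by move=> i; apply: summableZ; exact: summable_cell.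
apply: eq_bigr => i _.
by rewrite RintZ; [rewrite Rint_cell|exact: summable_cell].
Qed.

Lemma cell_mass_sum1 : \sum_i cell_mass i = 1.
Proof.
by rewrite -(Rint_cst P 1) (Rint_cells (fun=> 1)); under [RHS]eq_bigr do rewrite mul1r.
Qed.

End finite_partition.

Section glue.
Context d1 d2 (T1 : measurableType d1) (T2 : measurableType d2) (R : realType).
Variables (nu : probability T1 R) (rho : probability T2 R).
Variables (n : nat) (j : T2 -> 'I_n) (w : 'I_n -> T1 -> R).
Hypothesis mj : forall i, measurable (j @^-1` [set i]).
Local Notation p := (cell_mass rho j).
Hypothesis p_gt0 : forall i, 0 < p i.
Hypothesis sw : forall i, summable_fun nu (w i).
Hypothesis w_ge0 : forall i y, 0 <= w i y.
Hypothesis w_sum1 : forall y, \sum_i w i y = 1.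
Hypothesis w_mass : forall i, \int[nu]_y w i y = p i.

Let h (u : T1 * T2) : R :=
  \sum_i (w i u.1 / p i) * \1_(j @^-1` [set i]) u.2.

Let hE y z : h (y, z) = w (j z) y / p (j z).
Proof. exact/esym/(cell_expand (R := R) j (fun i => w i y / p i) z). Qed.

Let h_ge0 u : 0 <= h u.
Proof. by case: u => y z; rewrite hE divr_ge0// ltW. Qed.

Let mh : measurable_fun setT h.
Proof.
apply: measurable_sum => i; apply: measurable_funM.
  apply: measurable_funM => //; apply: (measurableT_comp _ measurable_fst).
  exact: summable_measurable (sw i).
apply: (measurableT_comp _ measurable_snd).
exact: measurable_indic.
Qed.

Let tonelli1 (f : T1 * T2 -> \bar R) : measurable_fun setT f ->
  (forall u, 0 <= f u)%E ->
  (\int[nu \x rho]_u (f u * (h u)%:E) =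
   \int[nu]_y \int[rho]_z (f (y, z) * (w (j z) y / p (j z))%:E))%E.
Proof.
move=> mf f0.
rewrite (fubini_tonelli1 (fun u => f u * (h u)%:E)%E); last 2 first.
- by apply: emeasurable_funM => //; exact/measurable_EFinP.
- by move=> u; rewrite mule_ge0// lee_fin.
by apply: eq_integral => y _; apply: eq_integral => z _; rewrite hE.
Qed.

Let tonelli2 (f : T1 * T2 -> \bar R) : measurable_fun setT f ->
  (forall u, 0 <= f u)%E ->
  (\int[nu \x rho]_u (f u * (h u)%:E) =
   \int[rho]_z \int[nu]_y (f (y, z) * (w (j z) y / p (j z))%:E))%E.
Proof.
move=> mf f0.
rewrite (fubini_tonelli2 (fun u => f u * (h u)%:E)%E); last 2 first.
- by apply: emeasurable_funM => //; exact/measurable_EFinP.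
- by move=> u; rewrite mule_ge0// lee_fin.
by apply: eq_integral => y _; apply: eq_integral => z _; rewrite hE.
Qed.

(** Second coordinate drawn from rho, then first coordinate drawn from nu with
    density w_i / p_i, where i is the cell of the second: given the cell, the
    coordinates are independent.  The three identities are its law on (cell,
    first coordinate) and its two marginals. *)
Lemma glue_coupling :
  exists pi : probability (T1 * T2)%type R,
   [/\ forall F : 'I_n -> T1 -> R, (forall i, measurable_fun setT (F i)) ->
         (forall i y, 0 <= F i y) ->
         (\int[pi]_u (F (j u.2) u.1)%:E = \int[nu]_y (\sum_i w i y * F i y)%:E)%E,
       forall f : T1 -> \bar R, measurable_fun setT f -> (forall y, 0 <= f y)%E ->
         (\int[pi]_u f u.1 = \int[nu]_y f y)%E &
       forall f : T2 -> \bar R, measurable_fun setT f -> (forall z, 0 <= f z)%E ->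
         (\int[pi]_u f u.2 = \int[rho]_z f z)%E].
Proof.
have inner y : (\int[rho]_z (w (j z) y / p (j z))%:E = 1)%E.
  rewrite -EFin_Rintegral; last exact: (summable_cells rho mj (fun i => w i y / p i)).
  rewrite (Rint_cells rho mj (fun i => w i y / p i)).
  congr EFin; rewrite -(w_sum1 y); apply: eq_bigr => i _.
  by rewrite divfK// gt_eqF.
have outer z : (\int[nu]_y (w (j z) y / p (j z))%:E = 1)%E.
  under eq_integral do rewrite mulrC.
  rewrite -EFin_Rintegral; last by apply: summableZ; exact: sw.
  by rewrite RintZ; [rewrite w_mass mulVf// gt_eqF|exact: sw].
have h1 : (\int[nu \x rho]_u (h u)%:E = 1)%E.
  under eq_integral do rewrite -[(h _)%:E]mul1e.
  rewrite (tonelli1 (f := fun=> 1%E))//.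
  under eq_integral do under eq_integral do rewrite mul1e.
  under eq_integral do rewrite inner.
  by rewrite integral_cst// mul1e; exact: probability_setT.
have [pi piE] := probability_density (P := (nu \x rho)%E) mh h_ge0 h1.
exists pi; split.
- move=> F mF F0.
  have mFj : measurable_fun setT (fun u : T1 * T2 => (F (j u.2) u.1)%:E).
    apply/measurable_EFinP.
    rewrite (_ : (fun _ => _) = fun u : T1 * T2 =>
        \sum_i F i u.1 * \1_(j @^-1` [set i]) u.2); last first.
      by apply/funext => u; exact: (cell_expand (R := R) j (fun i => F i u.1)).
    apply: measurable_sum => i; apply: measurable_funM.
      exact: (measurableT_comp (mF i) measurable_fst).
    by apply: (measurableT_comp _ measurable_snd); exact: measurable_indic.
  rewrite piE//; last by move=> u; rewrite lee_fin.
  rewrite tonelli1//; last by move=> u; rewrite lee_fin.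
  apply: eq_integral => y _ /=.
  under eq_integral do rewrite -EFinM.
  pose G i := F i y * (w i y / p i).
  rewrite -(@EFin_Rintegral _ _ _ _ (fun z => G (j z))); last exact: summable_cells.
  rewrite (Rint_cells rho mj G); congr EFin; apply: eq_bigr => i _.
  by rewrite /G -mulrA divfK 1?mulrC// gt_eqF.
- move=> f mf f0.
  have mf1 : measurable_fun setT (fun u : T1 * T2 => f u.1).
    exact: (measurableT_comp mf measurable_fst).
  rewrite piE// tonelli1//; apply: eq_integral => y _ /=.
  rewrite ge0_integralZl//; last 2 first.
  - apply/measurable_EFinP.
    exact: (measurable_cells mj (fun i => w i y / p i)).
  - by move=> z _; rewrite lee_fin divr_ge0// ltW.
  by rewrite inner mule1.
- move=> f mf f0.
  have mf2 : measurable_fun setT (fun u : T1 * T2 => f u.2).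
    exact: (measurableT_comp mf measurable_snd).
  rewrite piE// tonelli2//; apply: eq_integral => z _ /=.
  rewrite ge0_integralZl//; last 2 first.
  - apply/measurable_EFinP; apply: measurable_funM => //.
    exact: summable_measurable (sw _).
  - by move=> y _; rewrite lee_fin divr_ge0// ltW.
  by rewrite outer mule1.
Qed.

End glue.

(** * Maxima of finitely many affine functions *)

Fixpoint max_affine (R : realType) (d : nat) (a : nat -> 'rV[R]_d) (b : nat -> R)
    (n : nat) (x : 'rV[R]_d) : R :=
  let l := dotv x (a n) + b n in
  if n is m.+1 then Num.max (max_affine a b m x) l else l.

(** Convexity with an unbundled parameter s, free of the conversion between
    abstract convex combinations and sums of vectors. *)
Lemma convex_functionP (R : realType) (V : lmodType R) (f : V -> R) :
  convex_function [set: V] f <->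
  forall s x y, 0 <= s -> s <= 1 ->
    f (s *: x + (1 - s) *: y) <= s * f x + (1 - s) * f y.
Proof.
split=> [cf s x y s0 s1|h t x y _ _].
  by have := cf (Itv01 s0 s1) x y; rewrite !in_setT; exact.
exact: h.
Qed.

Section max_affine.
Variables (R : realType) (d : nat) (a : nat -> 'rV[R]_d) (b : nat -> R).
Implicit Types (x y : 'rV[R]_d) (n k : nat).

Lemma max_affine_ge n k x : (k <= n)%N -> dotv x (a k) + b k <= max_affine a b n x.
Proof.
elim: n => [|n ih]; first by rewrite leqn0 => /eqP ->.
rewrite leq_eqVlt => /orP[/eqP ->|]; first by rewrite le_max lexx orbT.
by rewrite ltnS => /ih h; rewrite le_max h.
Qed.

Lemma max_affine_le n x c :
  (forall k, (k <= n)%N -> dotv x (a k) + b k <= c) -> max_affine a b n x <= c.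
Proof.
elim: n => [|n ih] h; first exact: h.
by rewrite ge_max h// ih// => k kn; rewrite h// leqW.
Qed.

Lemma max_affine_nondecreasing x m n :
  (m <= n)%N -> max_affine a b m x <= max_affine a b n x.
Proof.
by move=> mn; apply: max_affine_le => k km; apply: max_affine_ge; exact: leq_trans mn.
Qed.

Lemma convex_max_affine n :
  convex_function [set: 'rV[R]_d] (max_affine a b n).
Proof.
apply/convex_functionP => s x y s0 s1; apply: max_affine_le => k kn.
rewrite dotvDl !dotvZl.
have := max_affine_ge x kn; have := max_affine_ge y kn.
have : 0 <= 1 - s by lra.
by nra.
Qed.

Lemma measurable_affine (v : 'rV[R]_d) (c : R) :
  measurable_fun setT (fun x : Rd R d => dotv (x : 'rV[R]_d) v + c).
Proof.
apply: measurable_funD => //; apply: measurable_fun_dotv => //.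
Qed.

Lemma measurable_max_affine n :
  measurable_fun setT (max_affine a b n : Rd R d -> R).
Proof.
elim: n => [|n ih]; first exact: measurable_affine.
by apply: measurable_maxr => //; exact: measurable_affine.
Qed.

(** The index is built along the recursion, so that its measurability reduces to
    that of comparing two functions. *)
Let active_index n : exists j : Rd R d -> nat,
  [/\ measurable_fun setT j, forall x, (j x <= n)%N &
      forall x, max_affine a b n x = dotv (x : 'rV[R]_d) (a (j x)) + b (j x)].
Proof.
elim: n => [|n [j [mj jn jE]]]; first by exists (fun=> 0%N).
pose l (x : Rd R d) := dotv (x : 'rV[R]_d) (a n.+1) + b n.+1.
exists (fun x => if max_affine a b n x < l x then n.+1 else j x); split.
- apply: measurable_fun_ifT => //; apply: measurable_fun_ltr.
    exact: measurable_max_affine.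
  exact: measurable_affine.
- by move=> x; case: ifP => // _; rewrite leqW.
- move=> x; transitivity (Num.max (max_affine a b n x) (l x)); first by [].
  by case: ltP => _; rewrite ?jE.
Qed.

Lemma max_affine_active n : exists j : Rd R d -> 'I_n.+1,
  (forall i, measurable (j @^-1` [set i])) /\
  forall x, max_affine a b n x = dotv (x : 'rV[R]_d) (a (j x)) + b (j x).
Proof.
have [j [mj jn jE]] := active_index n.
exists (fun x => inord (j x)); split=> [i|x]; last by rewrite inordK// ltnS.
rewrite (_ : _ @^-1` _ = j @^-1` [set val i]).
  by rewrite -[X in measurable X]setTI; exact: mj.
apply/seteqP; split => x /=; last by move=> ->; rewrite inord_val.
by move=> <-; rewrite inordK// ltnS.
Qed.

End max_affine.

(** * Second moments and couplings *)

Section transfer.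
Context d d' (T : measurableType d) (T' : measurableType d') (R : realType).
Variables (P : probability T R) (Q : probability T' R) (phi : T -> T').
Hypothesis mphi : measurable_fun setT phi.
Hypothesis PQ : forall A, measurable A -> P (phi @^-1` A) = Q A.

Lemma ge0_integral_transfer (f : T' -> \bar R) : measurable_fun setT f ->
  (forall x, 0 <= f x)%E -> (\int[P]_t f (phi t) = \int[Q]_x f x)%E.
Proof.
move=> mf f0; have := ge0_integral_pushforward mphi P measurableT mf (fun x _ => f0 x).
rewrite preimage_setT => <-; apply: eq_measure_integral => A mA _; exact: PQ.
Qed.

Lemma summable_transfer (f : T' -> R) :
  summable_fun Q f -> summable_fun P (fun t => f (phi t)).
Proof.
move=> sf; have mf := summable_measurable sf.
apply/integrableP; split.
  by apply/measurable_EFinP; exact: (measurableT_comp mf mphi).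
have /= -> := @ge0_integral_transfer (fun x => `|(f x)%:E|%E).
- by have /integrableP[] := sf.
- by do 2 apply: measurableT_comp => //.
- by [].
Qed.

Lemma Rint_transfer (f : T' -> R) :
  summable_fun Q f -> \int[P]_t f (phi t) = \int[Q]_x f x.
Proof.
move=> sf; have mf := summable_measurable sf.
have mef : measurable_fun setT (EFin \o f) by exact/measurable_EFinP.
congr fine; have := @integral_pushforward _ _ _ _ _ _ mphi P setT _ mef.
rewrite preimage_setT => /(_ (summable_transfer sf) measurableT)/= <-.
by apply: eq_measure_integral => A mA _; exact: PQ.
Qed.

End transfer.

Section second_moment.
Variables (R : realType) (d : nat) (mu : probability (Rd R d) R).
Hypothesis hmu : P2 mu.

Lemma measurable_dotv_self :
  measurable_fun setT (fun x : Rd R d => dotv (x : 'rV[R]_d) x).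
Proof. by apply: measurable_fun_dotv; exact: measurable_id. Qed.

Lemma moment2_dotv : (moment2 mu = \int[mu]_x (dotv (x : 'rV[R]_d) x)%:E)%E.
Proof. by apply: eq_integral => x _; rewrite euclidean_norm_sqr. Qed.

Lemma summable_dotv_self : summable_fun mu (fun x => dotv (x : 'rV[R]_d) x).
Proof.
apply: summable_ge0; first exact: measurable_dotv_self.
  by move=> x; exact: dotv_ge0.
by rewrite -moment2_dotv.
Qed.

Lemma moment2_Rintegral : (moment2 mu = (\int[mu]_x dotv (x : 'rV[R]_d) x)%:E)%E.
Proof. by rewrite EFin_Rintegral ?moment2_dotv//; exact: summable_dotv_self. Qed.

Lemma summable_affine (v : 'rV[R]_d) c :
  summable_fun mu (fun x => dotv (x : 'rV[R]_d) v + c).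
Proof.
apply: summableD; last exact: summable_cst.
apply: (summable_le (g := fun x : Rd R d => dotv (x : 'rV[R]_d) x + dotv v v)).
- by apply: measurable_fun_dotv => //; exact: measurable_id.
- by move=> x; exact: dotv_young.
- by apply: summableD; [exact: summable_dotv_self|exact: summable_cst].
Qed.

Lemma summable_max_affine a b n :
  summable_fun mu (max_affine a b n : Rd R d -> R).
Proof.
elim: n => [|n ih]; first exact: summable_affine.
apply: (summable_le (g := fun x : Rd R d =>
  `|max_affine a b n x| + `|dotv (x : 'rV[R]_d) (a n.+1) + b n.+1|)).
- exact: measurable_max_affine.
- move=> x /=; rewrite maxEle; case: ifP => _; first by rewrite lerDr.
  by rewrite lerDl.
- by apply: summableD; apply: summable_norm => //; exact: summable_affine.
Qed.

End second_moment.

Section coupling.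
Variables (R : realType) (d : nat) (mu nu : probability (Rd R d) R).
Variable pi : probability (Rd R d * Rd R d)%type R.

Lemma couplings_of_integrals :
  (forall f : Rd R d -> \bar R, measurable_fun setT f -> (forall x, 0 <= f x)%E ->
     (\int[pi]_u f u.1 = \int[mu]_x f x)%E) ->
  (forall f : Rd R d -> \bar R, measurable_fun setT f -> (forall x, 0 <= f x)%E ->
     (\int[pi]_u f u.2 = \int[nu]_x f x)%E) ->
  couplings mu nu pi.
Proof.
move=> h1 h2 A mA; rewrite /pushforward.
have mI : measurable_fun setT (fun x : Rd R d => (\1_A x : R)%:E).
  exact/measurable_EFinP/measurable_indic.
have I0 (x : Rd R d) : (0 <= (\1_A x : R)%:E)%E by rewrite lee_fin.
have mA1 : measurable (@fst (Rd R d) (Rd R d) @^-1` A).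
  by rewrite -[X in measurable X]setTI; exact: measurable_fst.
have mA2 : measurable (@snd (Rd R d) (Rd R d) @^-1` A).
  by rewrite -[X in measurable X]setTI; exact: measurable_snd.
split.
- have : (\int[pi]_u (\1_(@fst (Rd R d) (Rd R d) @^-1` A) u : R)%:E =
          \int[mu]_x (\1_A x : R)%:E)%E by exact: h1.
  by rewrite !integral_indic// !setIT.
- have : (\int[pi]_u (\1_(@snd (Rd R d) (Rd R d) @^-1` A) u : R)%:E =
          \int[nu]_x (\1_A x : R)%:E)%E by exact: h2.
  by rewrite !integral_indic// !setIT.
Qed.

Hypothesis hpi : couplings mu nu pi.

Lemma coupling_fst A : measurable A -> pi (fst @^-1` A) = mu A.
Proof. by move=> /hpi[]. Qed.

Lemma coupling_snd A : measurable A -> pi (snd @^-1` A) = nu A.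
Proof. by move=> /hpi[]. Qed.

Lemma transport_cost_dotv : (transport_cost pi = \int[pi]_u
  (dotv ((u.1 : 'rV[R]_d) - u.2) ((u.1 : 'rV[R]_d) - u.2))%:E)%E.
Proof. by apply: eq_integral => u _; rewrite euclidean_norm_sqr. Qed.

Lemma summable_cost : P2 mu -> P2 nu -> summable_fun pi (fun u =>
  dotv ((u.1 : 'rV[R]_d) - u.2) ((u.1 : 'rV[R]_d) - u.2)).
Proof.
move=> hmu hnu; apply: (summable_le (g := fun u : Rd R d * Rd R d =>
  2 * dotv (u.1 : 'rV[R]_d) u.1 + 2 * dotv (u.2 : 'rV[R]_d) u.2)).
- by apply: measurable_fun_dotvB; [exact: measurable_fst|exact: measurable_snd].
- move=> u; rewrite ger0_norm ?dotv_ge0//.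
  have := dotv_ge0 ((u.1 : 'rV[R]_d) + u.2).
  rewrite dotvB_sqr dotvDl !dotvDr (dotvC (u.2 : 'rV[R]_d) u.1); lra.
- apply: summableD; apply: summableZ.
  + exact: (summable_transfer (f := fun x : Rd R d => dotv (x : 'rV[R]_d) x)
      measurable_fst coupling_fst (summable_dotv_self _)).
  + exact: (summable_transfer (f := fun x : Rd R d => dotv (x : 'rV[R]_d) x)
      measurable_snd coupling_snd (summable_dotv_self _)).
Qed.

End coupling.

Section quantization.
Variables (R : realType) (d : nat).

(** Given points q_k, the index k.+1 of the last ball of radius r, among the
    first N ones, that contains z; the value 0 means that there is none. *)
Fixpoint ball_index (q : nat -> 'rV[R]_d) (r : R) (N : nat) (z : Rd R d) : nat :=
  if N is m.+1 then if `|(z : 'rV[R]_d) - q m| < r then N else ball_index q r m z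
  else 0.

Lemma ball_index_le q r N z : (ball_index q r N z <= N)%N.
Proof. by elim: N => // N ih /=; case: ifP => // _; rewrite leqW. Qed.

Lemma measurable_ball_index q r N : measurable_fun setT (ball_index q r N).
Proof.
elim: N => [|N ih] /=; first exact: measurable_cst.
apply: measurable_fun_ifT => //; apply: (measurable_fun_bool true).
rewrite setTI (_ : _ @^-1` _ = (ball (q N) r : set (Rd R d))).
  by apply: Rd_open_measurable; exact: ball_open.
by apply/seteqP; split => z; rewrite -ball_normE /= distrC.
Qed.

Let center (q : nat -> 'rV[R]_d) k := if k is m.+1 then q m else 0.

Lemma ball_index_dist q r N z : ball_index q r N z <> 0%N ->
  `|(z : 'rV[R]_d) - center q (ball_index q r N z)| < r.
Proof. by elim: N => //= N ih; case: ifP. Qed.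

Lemma ball_index_neq0 q r k N (z : Rd R d) :
  `|(z : 'rV[R]_d) - q k| < r -> (k < N)%N -> ball_index q r N z <> 0%N.
Proof.
move=> zk; elim: N => //= N ih; rewrite ltnS leq_eqVlt => /orP[/eqP <-|kN].
  by rewrite zk.
by case: ifP => // _; exact: ih.
Qed.

Variable rho : probability (Rd R d) R.
Hypothesis hrho : P2 rho.

(** Every point is eventually covered by a ball, so dominated convergence makes
    the second moment of the uncovered region tend to 0. *)
Lemma ball_index_tail q r : (forall x : 'rV[R]_d, exists k, `|x - q k| < r) ->
  (\int[rho]_z ((ball_index q r N z == 0%N)%:R * dotv (z : 'rV[R]_d) z)%:E
     @[N --> \oo] --> 0)%E.
Proof.
move=> qr.
pose f N (z : Rd R d) := ((ball_index q r N z == 0%N)%:R * dotv (z : 'rV[R]_d) z)%:E.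
have mf N : measurable_fun setT (f N).
  apply/measurable_EFinP; apply: measurable_funM; last exact: measurable_dotv_self.
  apply: (measurableT_comp (f := fun k : nat => (k == 0%N)%:R : R)) => //.
  exact: measurable_ball_index.
have [] := @dominated_convergence _ _ _ rho setT measurableT f (cst 0%E)
  (fun z => (dotv (z : 'rV[R]_d) z)%:E) mf (measurable_cst _).
- apply: aeW => z _ /=; have [k zk] := qr z.
  apply: cvg_near_cst; near=> N; rewrite /f.
  suff -> : (ball_index q r N z == 0%N) = false by rewrite mul0r.
  by apply/eqP; apply: (ball_index_neq0 zk); near: N; exact: nbhs_infty_gt.
- exact: summable_dotv_self.
- apply: aeW => z N _; rewrite /f /= lee_fin normrM.
  rewrite [`|dotv _ _|]ger0_norm ?dotv_ge0//.
  by case: (_ == _); rewrite ?normr1 ?mul1r// normr0 mul0r dotv_ge0.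
by move=> _ _; rewrite integral_cst// mul0e.
Unshelve. all: by end_near. Qed.

(** Covered points are within r of the centre of their ball; the uncovered ones
    are sent to 0 and contribute a small tail. *)
Lemma countable_quantization (e : R) : 0 < e ->
  exists N (J : Rd R d -> nat) (c : nat -> 'rV[R]_d),
   [/\ measurable_fun setT J, forall z, (J z <= N)%N &
     (\int[rho]_z (dotv ((z : 'rV[R]_d) - c (J z)) ((z : 'rV[R]_d) - c (J z)))%:E
        <= e%:E)%E].
Proof.
move=> e0; have [q qd] := rV_dense_seq R d.
pose r := Num.min 1 (e / (2 * d.+1%:R)).
have r0 : 0 < r by rewrite lt_min ltr01 divr_gt0// mulr_gt0.
have r1 : r <= 1 by rewrite ge_min lexx.
have re : d%:R * r ^+ 2 <= e / 2.
  apply: (@le_trans _ _ (d.+1%:R * r)).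
    apply: ler_pM; rewrite ?ler_nat ?sqr_ge0//.
    by rewrite expr2 ler_piMl// ltW.
  rewrite mulrC -ler_pdivlMr//; rewrite /r ge_min; apply/orP; right.
  by rewrite invfM mulrA.
have := ball_index_tail (q := q) (r := r) (fun x => qd x r r0).
move=> /fine_cvgP[fin0 /cvgrPdist_lt /(_ (e / 2))].
have e2 : 0 < e / 2 by rewrite divr_gt0.
move=> /(_ e2) lt0; have [N /= [finN ltN]] := filter_ex (filterI fin0 lt0).
have tailN : (\int[rho]_z ((ball_index q r N z == 0%N)%:R *
    dotv (z : 'rV[R]_d) z)%:E <= (e / 2)%:E)%E.
  rewrite -[leLHS]fineK// lee_fin.
  by move: ltN; rewrite sub0r normrN => /ltW; apply: le_trans; exact: ler_norm.
exists N, (ball_index q r N), (center q); split.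
- exact: measurable_ball_index.
- by move=> z; exact: ball_index_le.
have mtail : measurable_fun setT (fun z : Rd R d =>
    ((ball_index q r N z == 0%N)%:R * dotv (z : 'rV[R]_d) z)%:E).
  apply/measurable_EFinP; apply: measurable_funM; last exact: measurable_dotv_self.
  apply: (measurableT_comp (f := fun k : nat => (k == 0%N)%:R : R)) => //.
  exact: measurable_ball_index.
apply: (@le_trans _ _ (\int[rho]_z ((e / 2)%:E +
    ((ball_index q r N z == 0%N)%:R * dotv (z : 'rV[R]_d) z)%:E))%E).
  apply: ge0_le_integral => //.
  - by move=> z _; rewrite lee_fin dotv_ge0.
  - apply/measurable_EFinP/measurable_fun_dotvB; first exact: measurable_id.
    exact: (measurableT_comp (f := (center q : nat -> Rd R d))
      (fun _ _ _ => I) (measurable_ball_index q r N)).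
  - by apply: emeasurable_funD.
  - move=> z _; rewrite -EFinD lee_fin.
    have [J0|/eqP Jn0] := eqVneq (ball_index q r N z) 0%N.
      by rewrite J0 /= subr0 mul1r lerDr ltW.
    rewrite mul0r addr0; apply: (le_trans _ re); apply: dotv_le_sup.
    by apply: ltW; exact: ball_index_dist.
rewrite ge0_integralD//; last 2 first.
- by move=> z _; rewrite lee_fin ltW.
- by move=> z _; rewrite lee_fin mulr_ge0// dotv_ge0.
rewrite integral_cst//= [e in leRHS](_ : e = e / 2 + e / 2); last by field.
by rewrite EFinD; apply: leeD => //; rewrite (_ : rho setT = 1%E) ?mule1//; exact: probability_setT.
Qed.

End quantization.

(** The balls around finitely many points of a dense sequence quantize rho up
    to a small error.  Null cells are merged into a charged one, since the
    coercivity of the dual functional needs positive masses. *)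
Lemma finite_quantization (R : realType) (d : nat) (rho : probability (Rd R d) R)
    (hrho : P2 rho) (e : R) : 0 < e ->
  exists n (j : Rd R d -> 'I_n) (v : 'I_n -> 'rV[R]_d),
   [/\ forall i, measurable (j @^-1` [set i]), forall i, 0 < cell_mass rho j i &
     (\int[rho]_z (dotv ((z : 'rV[R]_d) - v (j z)) ((z : 'rV[R]_d) - v (j z)))%:E
        <= e%:E)%E].
Proof.
move=> e0; have [N [J [c [mJ JN intJ]]]] := countable_quantization hrho e0.
have mJset (B : set nat) : measurable (J @^-1` B).
  by rewrite -[X in measurable X]setTI; apply: mJ => //; exact: I.
pose charged : pred 'I_N.+1 := [pred i : 'I_N.+1 | (0 < rho (J @^-1` [set val i]))%E].
have inordJ z : val (inord (J z) : 'I_N.+1) = J z by rewrite /= inordK// ltnS.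
(* The points whose index has mass 0 form a countable union of null sets. *)
pose null (k : nat) := if charged (inord k) then set0 else J @^-1` [set k].
have null0 : rho.-negligible (\bigcup_k null k).
  apply: negligible_bigcup => k; rewrite /null; case: ifPn => [_|nc].
    exact: negligible_set0.
  have [kN|kN] := ltnP k N.+1; last first.
    rewrite (_ : J @^-1` [set k] = set0); first exact: negligible_set0.
    rewrite -subset0 => z /= Jz; have := JN z.
    by rewrite Jz => /(leq_trans kN); rewrite ltnn.
  apply/negligibleP; first exact: (mJset [set k]).
  move: nc; rewrite /charged /= inordK// lt0e measure_ge0 andbT negbK => /eqP.
  exact.
have notnull z : ~ (\bigcup_k null k) z -> charged (inord (J z)).
  apply: contra_notT => nc; exists (J z) => //.
  by rewrite /null (negbTE nc).
have [z0 z0P] : exists z, charged (inord (J z)).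
  apply: contrapT => /forallNP h.
  have : rho.-negligible [set: Rd R d].
    apply: negligibleS null0 => z _.
    by apply: contrapT => zn; exact: h z (notnull z zn).
  move=> /(negligibleP _ measurableT) r0.
  have := probability_setT rho; rewrite [X in X = _]r0 => /esym/eqP.
  by rewrite onee_eq0.
pose n := #|charged|.
pose phi (k : nat) : 'I_n := enum_rank_in (A := charged) z0P (inord k).
have phiK (i : 'I_n) : phi (val (enum_val (A := charged) i)) = i.
  by rewrite /phi inord_val enum_valK_in.
pose j z := phi (J z).
pose v (i : 'I_n) := c (val (enum_val (A := charged) i)).
have mj i : measurable (j @^-1` [set i]).
  by rewrite (_ : _ @^-1` _ = J @^-1` (phi @^-1` [set i]))//; exact: mJset.
exists n, j, v; split.
- exact: mj.
- move=> i; rewrite -lte_fin EFin_cell_mass//.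
  have h : charged (enum_val (A := charged) i) by exact: (enum_valP i).
  apply: (lt_le_trans h).
  apply: le_measure; rewrite ?inE; [exact: (mJset [set _])|exact: mj|].
  by move=> z /= Jz; rewrite /j Jz phiK.
- have mv (c' : nat -> 'rV[R]_d) : measurable_fun setT (fun z : Rd R d =>
      (dotv ((z : 'rV[R]_d) - c' (J z)) ((z : 'rV[R]_d) - c' (J z)))%:E).
    apply/measurable_EFinP/measurable_fun_dotvB; first exact: measurable_id.
    exact: (measurableT_comp (f := (c' : nat -> Rd R d)) (fun _ _ _ => I) mJ).
  have nonneg (c' : nat -> 'rV[R]_d) (z : Rd R d) : [set: Rd R d] z -> (0 <=
      (dotv ((z : 'rV[R]_d) - c' (J z)) ((z : 'rV[R]_d) - c' (J z)))%:E)%E.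
    by move=> _; rewrite lee_fin dotv_ge0.
  apply: le_trans intJ; rewrite le_eqVlt; apply/orP; left; apply/eqP.
  apply: (ge0_ae_eq_integral measurableT (mv (fun k => v (phi k))) (mv c)
    (nonneg (fun k => v (phi k))) (nonneg c)).
  apply: negligibleS null0 => z; apply: contra_notP => /notnull zP _.
  by rewrite /v /phi enum_rankK_in//= inordJ.
Qed.

(** * From the convex order to the Wasserstein inequality *)

Section semidiscrete.
Variables (R : realType) (d : nat) (mu nu rho : probability (Rd R d) R).
Hypotheses (hmu : P2 mu) (hnu : P2 nu) (cvx : convex_order mu nu).
Variables (pi : probability (Rd R d * Rd R d)%type R).
Hypothesis hpi : couplings mu rho pi.
Variables (n : nat) (j : Rd R d -> 'I_n) (v : 'I_n -> 'rV[R]_d).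
Hypothesis mj : forall i, measurable (j @^-1` [set i]).
Local Notation p := (cell_mass rho j).
Hypothesis p_gt0 : forall i, 0 < p i.

Lemma convex_order_max_affine a b m :
  \int[mu]_x max_affine a b m x <= \int[nu]_y max_affine a b m y.
Proof.
rewrite -lee_fin !EFin_Rintegral; try exact: summable_max_affine.
exact: cvx (@convex_max_affine R d a b m).
Qed.

Lemma summable_pi_dotv : summable_fun pi (fun u => dotv (u.1 : 'rV[R]_d) (v (j u.2))).
Proof.
apply: (summable_le (g := fun u : Rd R d * Rd R d =>
  dotv (u.1 : 'rV[R]_d) u.1 + dotv (v (j u.2)) (v (j u.2)))).
- apply: measurable_fun_dotv; first exact: measurable_fst.
  exact: (measurableT_comp (measurable_cells mj (v : 'I_n -> Rd R d)) measurable_snd).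
- by move=> u; exact: dotv_young.
- apply: summableD.
    exact: (summable_transfer (f := fun x : Rd R d => dotv (x : 'rV[R]_d) x)
      measurable_fst (coupling_fst hpi) (summable_dotv_self _)).
  exact: (summable_transfer (f := fun z => dotv (v (j z)) (v (j z)))
      measurable_snd (coupling_snd hpi)
      (summable_cells rho mj (fun i => dotv (v i) (v i)))).
Qed.

Lemma Rint_pi_cells (F : 'I_n -> R) :
  summable_fun pi (fun u => F (j u.2)) /\
  \int[pi]_u F (j u.2) = \sum_i F i * p i.
Proof.
split.
  exact: (summable_transfer (f := fun z => F (j z))
      measurable_snd (coupling_snd hpi) (summable_cells rho mj F)).
rewrite -(Rint_cells rho mj).
exact: (Rint_transfer (f := fun z => F (j z))
      measurable_snd (coupling_snd hpi) (summable_cells rho mj F)).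
Qed.

Lemma Rint_pi_dotvB :
  \int[pi]_u dotv ((u.1 : 'rV[R]_d) - v (j u.2)) ((u.1 : 'rV[R]_d) - v (j u.2)) =
  \int[mu]_x dotv (x : 'rV[R]_d) x + \sum_i dotv (v i) (v i) * p i -
  2 * \int[pi]_u dotv (u.1 : 'rV[R]_d) (v (j u.2)).
Proof.
have s1 : summable_fun pi (fun u => dotv (u.1 : 'rV[R]_d) u.1).
  exact: (summable_transfer (f := fun x : Rd R d => dotv (x : 'rV[R]_d) x)
      measurable_fst (coupling_fst hpi) (summable_dotv_self _)).
have [s2 e2] := Rint_pi_cells (fun i => dotv (v i) (v i)).
under eq_Rintegral do rewrite dotvB_sqr.
rewrite RintB; [|exact: summableD|by apply: summableZ; exact: summable_pi_dotv].
rewrite RintD// RintZ; last exact: summable_pi_dotv.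
rewrite e2; congr (_ + _ - _).
exact: (Rint_transfer (f := fun x : Rd R d => dotv (x : 'rV[R]_d) x)
      measurable_fst (coupling_fst hpi) (summable_dotv_self _)).
Qed.

(** With M the maximum of the affine functions y.v_i / tau - phi_i, the chain
    (correlation under pi) <= (dual value for mu) <= (dual value for nu) <=
    (correlation of the softmax weights) + n tau uses, in turn, the definition
    of M, the convex order applied to M, and [softmax_gap]. *)
Lemma semidiscrete_transport (e : R) : 0 < e ->
  exists w : 'I_n -> Rd R d -> R,
  [/\ (forall i, summable_fun nu (w i)) /\ (forall i y, 0 <= w i y),
      forall y, \sum_i w i y = 1, forall i, \int[nu]_y w i y = p i,
      summable_fun nu (fun y => \sum_i w i y *
         dotv ((y : 'rV[R]_d) - v i) ((y : 'rV[R]_d) - v i)) &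
      \int[nu]_y (\sum_i w i y *
         dotv ((y : 'rV[R]_d) - v i) ((y : 'rV[R]_d) - v i)) <=
      \int[nu]_y dotv (y : 'rV[R]_d) y - \int[mu]_x dotv (x : 'rV[R]_d) x +
      \int[pi]_u dotv ((u.1 : 'rV[R]_d) - v (j u.2)) ((u.1 : 'rV[R]_d) - v (j u.2))
      + e].
Proof.
move=> e0; pose i0 := j (0 : 'rV[R]_d).
have n0 : 0 < n%:R :> R by rewrite ltr0n (leq_ltn_trans (leq0n i0))// ltn_ord.
(* The loss n tau of [softmax_gap] is doubled when the square is expanded. *)
pose tau := e / (2 * n%:R).
have tau0 : 0 < tau by rewrite divr_gt0// mulr_gt0.
pose V i := tau^-1 *: v i.
pose g i (y : Rd R d) := dotv (y : 'rV[R]_d) (V i).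
have sg i : summable_fun nu (g i).
  have := summable_affine hnu (V i) 0.
  by under eq_fun do rewrite addr0.
have p1 : \sum_i p i = 1 by exact: cell_mass_sum1.
have [phi phimin] := dual_cost_minimizer i0 sg p_gt0 p1.
pose w := softmax g phi.
have sw i f : summable_fun nu f -> summable_fun nu (fun y => w i y * f y).
  exact: summable_softmaxM.
have w1 y : \sum_i w i y = 1 by exact: softmax_sum1.
have wp i : \int[nu]_y w i y = p i by exact: softmax_marginal.
have sw1 i : summable_fun nu (w i) by exact: summable_softmax.
have sd i : summable_fun nu (fun y => dotv (y : 'rV[R]_d) (v i)).
  by have := summable_affine hnu (v i) 0; under eq_fun do rewrite addr0.
have swd : summable_fun nu (fun y => \sum_i w i y * dotv (y : 'rV[R]_d) (v i)).
  by apply: summable_sum => i; exact: sw.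
have swc (c : 'I_n -> R) : summable_fun nu (fun y => \sum_i c i * w i y).
  by apply: summable_sum => i; exact: summableZ.
have swcE (c : 'I_n -> R) : \int[nu]_y (\sum_i c i * w i y) = \sum_i c i * p i.
  rewrite Rint_sum => [|i]; last exact: summableZ.
  by apply: eq_bigr => i _; rewrite RintZ// wp.
(* Indices beyond n repeat i0, which does not change the maximum. *)
pose a k := V (nth i0 (enum 'I_n) k).
pose b k := - phi ord0 (nth i0 (enum 'I_n) k).
pose M := max_affine a b n.
set X := \int[pi]_u dotv (u.1 : 'rV[R]_d) (v (j u.2)).
set Y := \int[nu]_y (\sum_i w i y * dotv (y : 'rV[R]_d) (v i)).
set Phi := \sum_i phi ord0 i * p i.
have [sphi ephi] := Rint_pi_cells (fun i => phi ord0 i).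
have lower : tau^-1 * X - Phi <= \int[mu]_x M x.
  rewrite -[Phi]ephi -RintZ; last exact: summable_pi_dotv.
  rewrite -RintB//; last by apply: summableZ; exact: summable_pi_dotv.
  have sM : summable_fun mu (M : Rd R d -> R) by exact: summable_max_affine.
  rewrite -(Rint_transfer (f := M : Rd R d -> R) measurable_fst (coupling_fst hpi) sM).
  apply: Rint_le.
  - by apply: summableB => //; apply: summableZ; exact: summable_pi_dotv.
  - exact: (summable_transfer (f := M : Rd R d -> R) measurable_fst (coupling_fst hpi) sM).
  - move=> u; rewrite -dotvZr.
    have := @max_affine_ge R d a b n (j u.2) u.1 (ltnW (ltn_ord _)).
    by rewrite /a /b nth_ord_enum.
have upper : \int[nu]_y M y <= tau^-1 * Y - Phi + n%:R.
  have -> : tau^-1 * Y - Phi + n%:R = \int[nu]_y (tau^-1 *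
      (\sum_i w i y * dotv (y : 'rV[R]_d) (v i)) -
      (\sum_i phi ord0 i * w i y) + n%:R).
    rewrite RintD; [|by apply: summableB => //; exact: summableZ|exact: summable_cst].
    by rewrite RintB//; [rewrite RintZ// Rint_cst swcE|exact: summableZ].
  apply: Rint_le; first exact: summable_max_affine.
    apply: summableD; last exact: summable_cst.
    by apply: summableB => //; exact: summableZ.
  move=> y; apply: max_affine_le => k _.
  apply: (le_trans (softmax_gap i0 g phi y (nth i0 (enum 'I_n) k))).
  rewrite lerD2r mulr_sumr -sumrB.
  apply: ler_sum => i _; rewrite /g /V dotvZr -/(w i y) le_eqVlt.
  by apply/orP; left; apply/eqP; ring.
have XY : X <= Y + e / 2.
  have := le_trans lower (le_trans (convex_order_max_affine a b n) upper).
  have -> : e / 2 = tau * n%:R by rewrite /tau; field; rewrite gt_eqF.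
  rewrite lerBlDr addrAC subrK -ler_pdivlMl ?invr_gt0// invrK mulrDr mulrA.
  by rewrite mulfV ?gt_eqF// mul1r.
have sq : (fun y : Rd R d => \sum_i w i y *
         dotv ((y : 'rV[R]_d) - v i) ((y : 'rV[R]_d) - v i)) =
     (fun y : Rd R d => dotv (y : 'rV[R]_d) y + \sum_i dotv (v i) (v i) * w i y
        - 2 * \sum_i w i y * dotv (y : 'rV[R]_d) (v i)).
  apply/funext => y.
  have -> : dotv (y : 'rV[R]_d) y = \sum_i w i y * dotv (y : 'rV[R]_d) y.
    by rewrite -mulr_suml w1 mul1r.
  rewrite mulr_sumr -big_split/= -sumrB; apply: eq_bigr => i _.
  by rewrite dotvB_sqr; ring.
have ssq : summable_fun nu (fun y => dotv (y : 'rV[R]_d) y +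
     \sum_i dotv (v i) (v i) * w i y - 2 * \sum_i w i y * dotv (y : 'rV[R]_d) (v i)).
  apply: summableB; last exact: summableZ.
  by apply: summableD => //; exact: summable_dotv_self.
exists w; split => //.
- by split => // i y; rewrite ltW// softmax_gt0.
- by rewrite sq.
rewrite sq RintB; [|by apply: summableD => //; exact: summable_dotv_self|exact: summableZ].
rewrite RintD//; last exact: summable_dotv_self.
rewrite swcE RintZ// Rint_pi_dotvB -/X -/Y.
move: XY; clear lower upper.
move: (X) (Y) (\int[nu]_y _) (\int[mu]_x _) (\sum_i _) => x y A B C.
by lra.
Qed.

End semidiscrete.

Section couplings_exist.
Variables (R : realType) (d : nat) (mu nu : probability (Rd R d) R).

Lemma product_coupling : couplings mu nu (mu \x nu)%E.
Proof.
move=> A mA; rewrite /pushforward; split.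
- have -> : (@fst (Rd R d) (Rd R d)) @^-1` A = A `*` setT.
    by apply/seteqP; split => u // -[].
  apply: (etrans (product_measure1E _ _ mA measurableT)).
  by rewrite -[RHS]mule1; congr (_ * _)%E; exact: probability_setT.
- have -> : (@snd (Rd R d) (Rd R d)) @^-1` A = setT `*` A.
    by apply/seteqP; split => u // -[].
  apply: (etrans (product_measure1E _ _ measurableT mA)).
  by rewrite -[RHS]mul1e; congr (_ * _)%E; exact: probability_setT.
Qed.

Lemma transport_cost_ge0 (pi : probability (Rd R d * Rd R d)%type R) :
  (0 <= transport_cost pi)%E.
Proof. by apply: integral_ge0 => u _; rewrite lee_fin sqr_ge0. Qed.

Lemma W2_sqr : (W2 mu nu ^+ 2 = ereal_inf (@transport_cost R d @` couplings mu nu))%E.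
Proof.
rewrite /W2 sqr_sqrte//; apply: le_ereal_inf_tmp => _ [pi _ <-].
exact: transport_cost_ge0.
Qed.

Lemma W2_sqr_le pi : couplings mu nu pi -> (W2 mu nu ^+ 2 <= transport_cost pi)%E.
Proof. by move=> hpi; rewrite W2_sqr; apply: ereal_inf_lbound; exists pi. Qed.

Lemma transport_cost_Rintegral pi : P2 mu -> P2 nu -> couplings mu nu pi ->
  (transport_cost pi = (\int[pi]_u
    dotv ((u.1 : 'rV[R]_d) - u.2) ((u.1 : 'rV[R]_d) - u.2))%:E)%E.
Proof.
by move=> hmu hnu hpi; rewrite transport_cost_dotv EFin_Rintegral//; exact: summable_cost hpi _ _.
Qed.

Lemma W2_sqr_fin_num : P2 mu -> P2 nu -> (W2 mu nu ^+ 2)%E \is a fin_num.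
Proof.
move=> hmu hnu; rewrite ge0_fin_numE; last first.
  rewrite W2_sqr; apply: le_ereal_inf_tmp => _ [pi _ <-]; exact: transport_cost_ge0.
apply: le_lt_trans (W2_sqr_le product_coupling) _.
by rewrite (transport_cost_Rintegral hmu hnu product_coupling) ltry.
Qed.

End couplings_exist.

Section forward.
Variables (R : realType) (d : nat) (mu nu rho : probability (Rd R d) R).
Hypotheses (hmu : P2 mu) (hnu : P2 nu) (hrho : P2 rho) (cvx : convex_order mu nu).

(** The quantization error t^2 is chosen so that Young's inequality, with its
    constant 1 + 1/t, still yields a total error of order t. *)
Lemma convex_order_coupling pi (e : R) : couplings mu rho pi -> 0 < e ->
  exists2 pi', couplings nu rho pi' &
    (transport_cost pi' <= moment2 nu - moment2 mu + transport_cost pi + e%:E)%E.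
Proof.
move=> hpi e0.
rewrite (transport_cost_Rintegral hmu hrho hpi).
rewrite !moment2_Rintegral// -EFinB -!EFinD.
set mn := \int[nu]_y _; set mm := \int[mu]_x _; set c := \int[pi]_u _.
have c0 : 0 <= c by apply: Rintegral_ge0 => u _; exact: dotv_ge0.
(* For t <= 1 the sum of all errors is at most t K. *)
pose K := 3 * c + `|mn - mm| + 8.
have K0 : 0 < K by rewrite ltr_wpDl// addr_ge0// mulr_ge0.
pose t := Num.min 1 (e / K).
have t0 : 0 < t by rewrite lt_min ltr01 divr_gt0.
have t1 : t <= 1 by rewrite ge_min lexx.
have tK : t * K <= e by rewrite -ler_pdivlMr// ge_min lexx orbT.
have [|n [j [v [mj p0 hq]]]] := finite_quantization hrho (e := t ^+ 2).
  by rewrite exprn_gt0.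
pose Fv i (y : Rd R d) := dotv ((y : 'rV[R]_d) - v i) ((y : 'rV[R]_d) - v i).
have mvj : measurable_fun setT (fun z => v (j z) : Rd R d).
  exact: (measurable_cells mj (v : 'I_n -> Rd R d)).
have m1 : measurable_fun setT (fun u : Rd R d * Rd R d => Fv (j u.2) u.1).
  apply: measurable_fun_dotvB; first exact: measurable_fst.
  exact: (measurableT_comp mvj measurable_snd).
have m2 : measurable_fun setT (fun z : Rd R d => Fv (j z) z).
  by apply: measurable_fun_dotvB => //; exact: measurable_id.
have sq : summable_fun rho (fun z => Fv (j z) z).
  apply: summable_ge0 => //; first by move=> z; exact: dotv_ge0.
  by apply: le_lt_trans hq _; rewrite ltry.
have sq2 : summable_fun pi (fun u => Fv (j u.2) u.2).
  exact: (summable_transfer (f := fun z => Fv (j z) z) measurable_snd (coupling_snd hpi)).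
have sq2E : \int[pi]_u Fv (j u.2) u.2 <= t ^+ 2.
  rewrite (Rint_transfer (f := fun z => Fv (j z) z) measurable_snd (coupling_snd hpi))//.
  by rewrite -lee_fin EFin_Rintegral.
have sc := summable_cost hpi hmu hrho.
have young1 : \int[pi]_u Fv (j u.2) u.1 <= (1 + t) * c + (1 + t^-1) * t ^+ 2.
  have h : \int[pi]_u Fv (j u.2) u.1 <=
      \int[pi]_u ((1 + t) * dotv ((u.1 : 'rV[R]_d) - u.2) ((u.1 : 'rV[R]_d) - u.2) +
        (1 + t^-1) * Fv (j u.2) u.2).
    have s : summable_fun pi (fun u => (1 + t) *
        dotv ((u.1 : 'rV[R]_d) - u.2) ((u.1 : 'rV[R]_d) - u.2) +
        (1 + t^-1) * Fv (j u.2) u.2).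
      by apply: summableD; apply: summableZ.
    have le u : Fv (j u.2) u.1 <= (1 + t) *
        dotv ((u.1 : 'rV[R]_d) - u.2) ((u.1 : 'rV[R]_d) - u.2) +
        (1 + t^-1) * Fv (j u.2) u.2.
      have := dotvD_young ((u.1 : 'rV[R]_d) - u.2) ((u.2 : 'rV[R]_d) - v (j u.2)) t0.
      by rewrite addrA subrK.
    apply: Rint_le => //; apply: (summable_le _ _ s) => // u.
    by rewrite ger0_norm// dotv_ge0.
  apply: (le_trans h); rewrite RintD; [|exact: summableZ|exact: summableZ].
  rewrite !RintZ// lerD2l ler_wpM2l// addr_ge0// invr_ge0 ltW//.
have [w [[sw w0] w1 wp swF hw]] := semidiscrete_transport hmu hnu cvx hpi v mj p0 t0.
have [pi' [int1 int2 int3]] := glue_coupling mj p0 sw w0 w1 wp.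
exists pi'; first exact: couplings_of_integrals.
have intA : (\int[pi']_u (Fv (j u.2) u.1)%:E <=
    (mn - mm + ((1 + t) * c + (1 + t^-1) * t ^+ 2) + t)%:E)%E.
  rewrite int1; last 2 first.
  - by move=> i; apply: measurable_fun_dotvB; [exact: measurable_id|exact: measurable_cst].
  - by move=> i y; exact: dotv_ge0.
  rewrite -EFin_Rintegral// lee_fin; apply: (le_trans hw).
  by rewrite lerD2r lerD2l.
have intB : (\int[pi']_u (Fv (j u.2) u.2)%:E <= (t ^+ 2)%:E)%E.
  apply: le_trans hq; rewrite (int3 (fun z => (Fv (j z) z)%:E))//.
    exact/measurable_EFinP.
  by move=> z; rewrite lee_fin dotv_ge0.
rewrite transport_cost_dotv.
apply: (@le_trans _ _ (\int[pi']_u ((1 + t)%:E * (Fv (j u.2) u.1)%:E +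
    (1 + t^-1)%:E * (Fv (j u.2) u.2)%:E))%E).
  apply: ge0_le_integral => //.
  - by move=> u _; rewrite lee_fin dotv_ge0.
  - apply/measurable_EFinP/measurable_fun_dotvB; [exact: measurable_fst|exact: measurable_snd].
  - apply: emeasurable_funD; apply: emeasurable_funM => //; apply/measurable_EFinP => //.
    exact: (measurableT_comp m2 measurable_snd).
  - move=> u _; rewrite -!EFinM -EFinD lee_fin.
    have := dotvD_young ((u.1 : 'rV[R]_d) - v (j u.2)) (v (j u.2) - (u.2 : 'rV[R]_d)) t0.
    rewrite addrA subrK [Fv _ u.2]/Fv -[(u.2 : 'rV[R]_d) - _]opprB dotvNl.
    by rewrite [dotv _ (- _)]dotvC dotvNl opprK.
have t0' : 0 <= 1 + t^-1 by rewrite addr_ge0// invr_ge0 ltW.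
have t0'' : 0 <= 1 + t by rewrite addr_ge0// ltW.
rewrite ge0_integralD//; last 4 first.
- by move=> u _; rewrite mule_ge0// lee_fin// dotv_ge0.
- by apply: emeasurable_funM => //; exact/measurable_EFinP.
- by move=> u _; rewrite mule_ge0// lee_fin// dotv_ge0.
- apply: emeasurable_funM => //; apply/measurable_EFinP.
  exact: (measurableT_comp m2 measurable_snd).
rewrite !ge0_integralZl//; last 4 first.
- apply/measurable_EFinP; exact: (measurableT_comp m2 measurable_snd).
- by move=> u _; rewrite lee_fin dotv_ge0.
- exact/measurable_EFinP.
- by move=> u _; rewrite lee_fin dotv_ge0.
apply: (@le_trans _ _ ((1 + t)%:E *
    (mn - mm + ((1 + t) * c + (1 + t^-1) * t ^+ 2) + t)%:E +
    (1 + t^-1)%:E * (t ^+ 2)%:E)%E).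
  by apply: leeD; apply: lee_wpmul2l; rewrite ?lee_fin.
rewrite -!EFinM -EFinD lee_fin.
have -> : (1 + t^-1) * t ^+ 2 = t ^+ 2 + t by field; rewrite gt_eqF.
have := ler_norm (mn - mm).
move: tK; rewrite /K; move: (mn - mm) (`|mn - mm|) => D D' tK DD'.
have tD : t * D <= t * D' by rewrite ler_wpM2l// ltW.
have t2 : t ^+ 2 <= t by rewrite expr2 ler_piMl// ltW.
have t3 : t ^+ 3 <= t by rewrite exprS ler_piMr ?(le_trans t2)// ltW.
have t2c : t ^+ 2 * c <= t * c by rewrite ler_wpM2r.
clear - tK tD t2 t3 t2c; nra.
Qed.

Lemma W2_le_of_convex_order :
  (W2 nu rho ^+ 2 - W2 mu rho ^+ 2 <= moment2 nu - moment2 mu)%E.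
Proof.
rewrite leeBlDr; last exact: W2_sqr_fin_num.
apply/lee_addgt0Pr => e e0; have e2 : 0 < e / 2 by rewrite divr_gt0.
have := W2_sqr_fin_num hmu hrho; rewrite [(W2 mu rho ^+ 2)%E]W2_sqr.
move=> /(lb_ereal_inf_adherent e2)[_ [pi hpi <-] ltpi].
have [pi' hpi' le'] := convex_order_coupling hpi e2.
apply: (le_trans (W2_sqr_le hpi')); apply: (le_trans le').
move: ltpi; rewrite -W2_sqr => ltpi.
apply: (@le_trans _ _ (moment2 nu - moment2 mu +
  (W2 mu rho ^+ 2 + (e / 2)%:E) + (e / 2)%:E)%E).
  by rewrite leeD2r// leeD2l// ltW.
by rewrite -!addeA -EFinD -splitr.
Qed.

End forward.

(** * Convex functions on R^d as countable suprema of affine functions *)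

Section convex_functions.
Variables (R : realType) (d : nat) (f : 'rV[R]_d -> R).
Hypothesis cf : forall s x y, 0 <= s -> s <= 1 ->
  f (s *: x + (1 - s) *: y) <= s * f x + (1 - s) * f y.
Implicit Types (x y h q v : 'rV[R]_d) (i : 'I_d).

Let first_coords (k : nat) h := forall i, (k <= i)%N -> h ord0 i = 0.
Let e_ i : 'rV[R]_d := delta_mx ord0 i.

Let first_coords0 h : first_coords 0 h -> h = 0.
Proof. by move=> h0; apply/rowP => i; rewrite mxE h0. Qed.

Let first_coordsS i h : first_coords i.+1 h ->
  exists2 h', first_coords i h' & h = h' + h ord0 i *: e_ i.
Proof.
move=> hS; exists (h - h ord0 i *: e_ i); last by rewrite subrK.
move=> k; rewrite leq_eqVlt => /orP[/eqP ik|ik].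
  by rewrite (val_inj ik : i = k) !mxE !eqxx mulr1 subrr.
by rewrite !mxE eqxx (hS _ ik) -val_eqE/= (gtn_eqF ik) mulr0 subrr.
Qed.

Let first_coordsD k (h h' : 'rV[R]_d) (s s' : R) :
  first_coords k h -> first_coords k h' -> first_coords k (s *: h + s' *: h').
Proof. by move=> lh lh' i ki; rewrite !mxE lh// lh'// !mulr0 addr0. Qed.

Lemma convex_segment_bound x v (r s : R) : `|s| <= r ->
  f (x + s *: v) <= Num.max (f (x + r *: v)) (f (x - r *: v)).
Proof.
move=> sr; have r0 : 0 <= r by exact: le_trans sr.
have [r00|rn0] := eqVneq r 0.
  by move: sr; rewrite r00 normr_le0 => /eqP ->; rewrite le_max lexx.
have rp : 0 < r by rewrite lt_neqAle eq_sym rn0.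
move: sr; rewrite ler_norml => /andP[sr1 sr2].
(* x + s v is the barycentre of the two end points with weights t and 1 - t. *)
pose t := (r + s) / (2 * r).
have t0 : 0 <= t by rewrite divr_ge0//; lra.
have t1 : t <= 1 by rewrite ler_pdivrMr; lra.
have -> : x + s *: v = t *: (x + r *: v) + (1 - t) *: (x - r *: v).
  apply/rowP => i; rewrite !mxE /t; field.
  by rewrite gt_eqF.
apply: (le_trans (cf _ _ t0 t1)).
set m := Num.max _ _.
have m1 : f (x + r *: v) <= m by rewrite le_max lexx.
have m2 : f (x - r *: v) <= m by rewrite le_max lexx orbT.
have t2 : 0 <= 1 - t by lra.
nra.
Qed.

(** A cube is handled one coordinate at a time: x + h + s e is the midpoint of
    x + 2h and x + 2s e, so the statement in dimension k is used with a radius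
    twice as large. *)
Lemma convex_locally_bounded x (r : R) :
  exists M, forall h, (forall i, `|h ord0 i| <= r) -> f (x + h) <= M.
Proof.
suff [M hM] : exists M, forall h, first_coords d h ->
    (forall i, `|h ord0 i| <= r) -> f (x + h) <= M.
  by exists M => h; apply: hM => i; rewrite leqNgt ltn_ord.
suff H k : (k <= d)%N -> forall r : R, exists M, forall h, first_coords k h ->
    (forall i, `|h ord0 i| <= r) -> f (x + h) <= M by exact: H.
elim: k => [_ {}r|k ih kd {}r].
  by exists (f x) => h /first_coords0 -> _; rewrite addr0.
have [M hM] := ih (ltnW kd) (2 * r).
pose i := Ordinal kd.
pose N := Num.max (f (x + (2 * r) *: e_ i)) (f (x - (2 * r) *: e_ i)).
exists (2^-1 * M + (1 - 2^-1) * N) => h /(@first_coordsS i)[h' lh' hE] hr.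
have -> : x + h = 2^-1 *: (x + 2 *: h') + (1 - 2^-1) *: (x + (2 * h ord0 i) *: e_ i).
  by rewrite {1}hE; apply/rowP => l; rewrite !mxE; field.
apply: (le_trans (cf _ _ _ _)); [by rewrite invr_ge0|by rewrite invf_le1//; lra|].
have h1 : f (x + 2 *: h') <= M.
  apply: hM => [l kl|l]; first by rewrite mxE lh'// mulr0.
  rewrite mxE normrM ger0_norm// ler_wpM2l//.
  have [li|li] := leqP k l.
    by rewrite lh'// normr0 (le_trans _ (hr l)).
  have := hr l; rewrite hE !mxE eqxx -val_eqE/= (ltn_eqF li) mulr0 addr0.
  exact.
have h2 : f (x + (2 * h ord0 i) *: e_ i) <= N.
  by apply: convex_segment_bound; rewrite normrM ger0_norm// ler_wpM2l.
lra.
Qed.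

(** x is a convex combination of x + u and of the opposite point x - u / t,
    where f is at most M. *)
Lemma convex_lower_modulus x u (t M : R) : 0 < t -> f (x - t^-1 *: u) <= M ->
  f x - t * (M - f x) <= f (x + u).
Proof.
move=> t0 fM; have t1 : 0 < 1 + t by lra.
have s0 : 0 <= (1 + t)^-1 by rewrite invr_ge0 ltW.
have s1 : (1 + t)^-1 <= 1 by rewrite invf_le1//; lra.
have e : x = (1 + t)^-1 *: (x + u) + (1 - (1 + t)^-1) *: (x - t^-1 *: u).
  apply/rowP => i; rewrite !mxE; field.
  by rewrite !gt_eqF.
have := cf (x + u) (x - t^-1 *: u) s0 s1; rewrite -e => h.
have : (1 + t) * f x <= f (x + u) + t * f (x - t^-1 *: u).
  apply: (@le_trans _ _ ((1 + t) * ((1 + t)^-1 * f (x + u) +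
     (1 - (1 + t)^-1) * f (x - t^-1 *: u)))); first by rewrite ler_pM2l.
  rewrite le_eqVlt; apply/orP; left; apply/eqP; field.
  by rewrite gt_eqF.
nra.
Qed.

(** Hahn-Banach in finite dimension: a linear minorant of h |-> f (x + h) - f x
    on vectors supported on the first k coordinates extends to one more
    coordinate, its slope there being the supremum L of the lower bounds, which
    convexity keeps below all upper bounds. *)
Lemma convex_subgradient x : exists p, forall y, f x + dotv (y - x) p <= f y.
Proof.
pose F h := f (x + h) - f x.
have cF s h h' : 0 <= s -> s <= 1 ->
    F (s *: h + (1 - s) *: h') <= s * F h + (1 - s) * F h'.
  move=> s0 s1; have := cf (x + h) (x + h') s0 s1; rewrite /F.
  have -> : s *: (x + h) + (1 - s) *: (x + h') = x + (s *: h + (1 - s) *: h').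
    by apply/rowP => i; rewrite !mxE; ring.
  lra.
suff H k : (k <= d)%N -> exists p, forall h, first_coords k h -> dotv h p <= F h.
  have [p hp] := H d (leqnn d); exists p => y.
  have := hp (y - x) _; rewrite /F [x + _]addrC subrK => h.
  rewrite addrC -lerBrDr; apply: h => i; first by rewrite leqNgt ltn_ord.
elim: k => [_|k ih kd].
  by exists 0 => h /first_coords0 ->; rewrite /F addr0 subrr -(scale0r 0) dotvZl mul0r.
have [p hp] := ih (ltnW kd); pose i := Ordinal kd.
(* Lower bounds that the slope along e_i has to exceed. *)
pose L := [set c | exists s h,
  [/\ 0 < s, first_coords k h & c = (dotv h p - F (h - s *: e_ i)) / s]].
have LU s' h' : 0 < s' -> first_coords k h' ->
    ubound L ((F (h' + s' *: e_ i) - dotv h' p) / s').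
  move=> s'0 lh' _ [s [h [s0 lh ->]]].
  have ss : 0 < s + s' by lra.
  pose t := s' / (s + s').
  have t0 : 0 <= t by rewrite divr_ge0// ltW.
  have t1 : t <= 1 by rewrite ler_pdivrMr// mul1r; lra.
  have := cF t (h - s *: e_ i) (h' + s' *: e_ i) t0 t1.
  have -> : t *: (h - s *: e_ i) + (1 - t) *: (h' + s' *: e_ i) =
            t *: h + (1 - t) *: h'.
    apply/rowP => l; rewrite !mxE /t; field.
    by rewrite gt_eqF.
  have := hp _ (first_coordsD t (1 - t) lh lh'); rewrite dotvDl !dotvZl.
  move: (F (h - _)) (F (h' + _)) (F _) (dotv h p) (dotv h' p) => A B C D E h1 h2.
  have {h1 h2} h3 := le_trans h1 h2.
  rewrite ler_pdivrMr// mulrAC ler_pdivlMr//.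
  have : (s + s') * (t * D + (1 - t) * E) <= (s + s') * (t * A + (1 - t) * B).
    by rewrite ler_pM2l.
  have -> : (s + s') * (t * D + (1 - t) * E) = s' * D + s * E.
    by rewrite /t; field; rewrite gt_eqF.
  have -> : (s + s') * (t * A + (1 - t) * B) = s' * A + s * B.
    by rewrite /t; field; rewrite gt_eqF.
  lra.
have first_coords0k : first_coords k 0 by move=> l _; rewrite mxE.
have Lsup : has_sup L.
  split; first by exists ((dotv 0 p - F (0 - 1 *: e_ i)) / 1), 1, 0; split.
  by exists ((F (0 + 1 *: e_ i) - dotv 0 p) / 1); exact: LU.
pose c := sup L.
(* p with its i-th coordinate replaced by c. *)
pose p' := p + (c - p ord0 i) *: e_ i.
have de h : dotv h (e_ i) = h ord0 i.
  rewrite /dotv (bigD1 i)//= big1 ?addr0; first by rewrite mxE !eqxx mulr1.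
  by move=> l li; rewrite mxE (negbTE li) andbF mulr0.
have pe : dotv (e_ i) p' = c.
  rewrite dotvDr dotvZr de dotvC de mxE !eqxx mulr1; ring.
exists p' => h /(@first_coordsS i)[h' lh' ->].
rewrite dotvDl dotvZl pe dotvDr dotvZr de lh'// mulr0 addr0.
move: (h ord0 i) => s.
have [s0|s0|->] := ltgtP s 0.
- have s0' : 0 < - s by rewrite oppr_gt0.
  have : (dotv h' p - F (h' - (- s) *: e_ i)) / (- s) <= c.
    by apply: (ub_le_sup Lsup.2); exists (- s), h'; split.
  by rewrite ler_pdivrMr// scaleNr opprK; lra.
- have : c <= (F (h' + s *: e_ i) - dotv h' p) / s.
    by apply: (ge_sup Lsup.1); exact: LU.
  by rewrite ler_pdivlMr//; lra.
- by rewrite mul0r addr0 scale0r addr0; exact: hp.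
Qed.

(** Tangent affine functions at the points of a dense sequence suffice, because
    near x the slopes are bounded by local upper bounds of f. *)
Lemma convex_countable_sup : exists (a : nat -> 'rV[R]_d) (b : nat -> R),
  (forall k x, dotv x (a k) + b k <= f x) /\
  (forall x (e : R), 0 < e -> exists k, f x - e < dotv x (a k) + b k).
Proof.
have [q qd] := rV_dense_seq R d.
pose a k := projT1 (cid (convex_subgradient (q k))).
have aP k y : f (q k) + dotv (y - q k) (a k) <= f y.
  by rewrite /a; case: cid.
exists a, (fun k => f (q k) - dotv (q k) (a k)); split=> [k x|x e e0].
  by have := aP k x; rewrite dotvBl; lra.
(* M bounds f on the unit ball around x; the error below is 3 t (M - f x). *)
have [M hM] := convex_locally_bounded x 1.
have coord v i : `|v ord0 i| <= `|v|.
  rewrite [in leRHS]/Num.norm/= mx_normrE.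
  exact: (le_bigmax _ (fun k => `|v k.1 k.2|) (ord0, i)).
have {coord} hM v : `|v| <= 1 -> f (x + v) <= M.
  by move=> v1; apply: hM => i; exact: le_trans (coord v i) v1.
have fxM : f x <= M by have := hM 0; rewrite normr0 addr0; exact.
pose t := Num.min 1 (e / (3 * (M - f x) + 1)).
have D0 : 0 < 3 * (M - f x) + 1 by lra.
have t0 : 0 < t by rewrite lt_min ltr01 divr_gt0.
have t1 : t <= 1 by rewrite ge_min lexx.
have te : t * (3 * (M - f x) + 1) <= e by rewrite -ler_pdivlMr// ge_min lexx orbT.
have [k kt] : exists k, `|x - q k| < t / 2 by apply: qd; rewrite divr_gt0.
exists k; set u := q k - x.
have ut : `|u| <= t / 2 by rewrite /u distrC ltW.
have tu : `|t^-1 *: u| <= 2^-1.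
  rewrite normrZ ger0_norm ?invr_ge0 ?(ltW t0)// ler_pdivrMl//.
have fq : f x - t * (M - f x) <= f (q k).
  have -> : q k = x + u by rewrite /u addrC subrK.
  apply: convex_lower_modulus => //; apply: hM; rewrite normrN.
  by apply: (le_trans tu); lra.
have slope : dotv u (a k) <= t * (M - f (q k)).
  have := aP k (q k + t^-1 *: u).
  rewrite [q k + _]addrC addrK dotvZl => h.
  have : f (t^-1 *: u + q k) <= M.
    have -> : t^-1 *: u + q k = x + (u + t^-1 *: u).
      by apply/rowP => i; rewrite !mxE; ring.
    apply: hM; apply: (le_trans (ler_normD _ _)).
    by apply: (le_trans (lerD ut tu)); lra.
  rewrite -ler_pdivrMl//; lra.
have -> : dotv x (a k) + (f (q k) - dotv (q k) (a k)) = f (q k) - dotv u (a k).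
  by rewrite dotvBl; ring.
apply: (@lt_le_trans _ _ ((1 + t) * f (q k) - t * M)); last first.
  by move: slope; lra.
have : (1 + t) * (f x - t * (M - f x)) <= (1 + t) * f (q k).
  by rewrite ler_pM2l//; lra.
have t2 : t ^+ 2 * (M - f x) <= t * (M - f x).
  by rewrite ler_wpM2r ?subr_ge0// expr2 ler_piMl// ltW.
clear - te t0 t2; lra.
Qed.

End convex_functions.

(** * From the Wasserstein inequality to the convex order *)

Section finite_support.
Variables (R : realType) (d : nat) (s : seq 'rV[R]_d).
Hypothesis us : uniq s.

(** A function given on the finite set s, extended by 0: the conjugate f^* is
    needed only on the slopes of f, and is infinite far away from them. *)
Definition atomic_fun (g : 'rV[R]_d -> R) (z : Rd R d) : R :=
  \sum_(v <- s) g v * \1_[set v] (z : 'rV[R]_d).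

Lemma atomic_funE g z : atomic_fun g z = if (z : 'rV[R]_d) \in s then g z else 0.
Proof.
rewrite /atomic_fun; case: ifPn => zs.
  rewrite (bigD1_seq (z : 'rV[R]_d))//= indicE mem_set// mulr1 big1 ?addr0//.
  by move=> v vz; rewrite indicE memNset ?mulr0//= => /esym/eqP; exact/negP.
rewrite big_seq big1// => v vs; rewrite indicE memNset ?mulr0//= => zv.
by move: zs; rewrite zv vs.
Qed.

Lemma summable_atomic_fun (P : probability (Rd R d) R) g :
  summable_fun P (atomic_fun g).
Proof.
apply: summable_sum => v; apply: summableZ.
exact: integrable_indic (measurable_Rd_set1 v).
Qed.

Variables (nu rho : probability (Rd R d) R).
Hypotheses (hnu : P2 nu) (hrho : P2 rho).
Hypothesis rho_s : rho.-negligible [set z : Rd R d | (z : 'rV[R]_d) \notin s].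
Variables (f g : 'rV[R]_d -> R).
Hypothesis sf : summable_fun nu (f : Rd R d -> R).
Hypothesis fg : forall y v, v \in s -> dotv y v <= f y + g v.

Lemma summable_coupling_dotv pi : couplings nu rho pi ->
  summable_fun pi (fun u => dotv (u.1 : 'rV[R]_d) u.2).
Proof.
move=> hpi; apply: (summable_le (g := fun u : Rd R d * Rd R d =>
  dotv (u.1 : 'rV[R]_d) u.1 + dotv (u.2 : 'rV[R]_d) u.2)).
- by apply: measurable_fun_dotv; [exact: measurable_fst|exact: measurable_snd].
- by move=> u; exact: dotv_young.
- apply: summableD.
    exact: (summable_transfer (f := fun x : Rd R d => dotv (x : 'rV[R]_d) x)
      measurable_fst (coupling_fst hpi) (summable_dotv_self _)).
  exact: (summable_transfer (f := fun x : Rd R d => dotv (x : 'rV[R]_d) x)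
      measurable_snd (coupling_snd hpi) (summable_dotv_self _)).
Qed.

Lemma Rint_coupling_dotvB pi : couplings nu rho pi ->
  \int[pi]_u dotv ((u.1 : 'rV[R]_d) - u.2) ((u.1 : 'rV[R]_d) - u.2) =
  \int[nu]_x dotv (x : 'rV[R]_d) x + \int[rho]_x dotv (x : 'rV[R]_d) x -
  2 * \int[pi]_u dotv (u.1 : 'rV[R]_d) u.2.
Proof.
move=> hpi; pose D (x : Rd R d) := dotv (x : 'rV[R]_d) x.
have s1 : summable_fun pi (fun u => D u.1).
  exact: (summable_transfer measurable_fst (coupling_fst hpi) (summable_dotv_self _)).
have s2 : summable_fun pi (fun u => D u.2).
  exact: (summable_transfer measurable_snd (coupling_snd hpi) (summable_dotv_self _)).
have s3 := summable_coupling_dotv hpi.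
under eq_Rintegral do rewrite dotvB_sqr.
rewrite RintB; [|exact: summableD|exact: summableZ].
rewrite RintD// RintZ//; congr (_ + _ - _).
  exact: (Rint_transfer (f := D) measurable_fst (coupling_fst hpi) (summable_dotv_self _)).
exact: (Rint_transfer (f := D) measurable_snd (coupling_snd hpi) (summable_dotv_self _)).
Qed.

(** The second coordinate lies in s almost surely, and there the integrand is
    at most f + g. *)
Lemma fenchel_coupling pi : couplings nu rho pi ->
  \int[pi]_u dotv (u.1 : 'rV[R]_d) u.2 <=
  \int[nu]_y f y + \int[rho]_z atomic_fun g z.
Proof.
move=> hpi; have s3 := summable_coupling_dotv hpi.
have s1 : summable_fun pi (fun u => f u.1).
  exact: (summable_transfer (f := f : Rd R d -> R) measurable_fst (coupling_fst hpi)).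
have s2 : summable_fun pi (fun u => atomic_fun g u.2).
  exact: (summable_transfer measurable_snd (coupling_snd hpi) (summable_atomic_fun _ _)).
have s12 := summableD s1 s2.
pose one := atomic_fun (fun=> 1).
(* k agrees with the correlation almost surely and satisfies the bound
   everywhere. *)
pose k (u : Rd R d * Rd R d) := one u.2 * dotv (u.1 : 'rV[R]_d) u.2 +
  (1 - one u.2) * (f u.1 + atomic_fun g u.2).
have mone : measurable_fun setT one.
  by apply: (summable_measurable (P := rho)); exact: summable_atomic_fun.
have mone2 : measurable_fun setT (fun u : Rd R d * Rd R d => one u.2).
  exact: (measurableT_comp mone measurable_snd).
have mk : measurable_fun setT k.
  apply: measurable_funD; apply: measurable_funM => //.
  - exact: summable_measurable s3.
  - exact: measurable_funB.
  - exact: summable_measurable s12.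
have kle u : `|k u| <= `|dotv (u.1 : 'rV[R]_d) u.2| + `|f u.1 + atomic_fun g u.2|.
  rewrite /k /one atomic_funE; case: ifP => _.
    by rewrite mul1r subrr mul0r addr0 lerDl.
  by rewrite mul0r subr0 mul1r add0r lerDr.
have sk : summable_fun pi k.
  by apply: (summable_le mk kle); apply: summableD; exact: summable_norm.
have -> : \int[pi]_u dotv (u.1 : 'rV[R]_d) u.2 = \int[pi]_u k u.
  congr fine; apply: ae_eq_integral => //.
  - by have := measurable_int _ s3.
  - exact/measurable_EFinP.
  have [N [mN N0 sN]] := rho_s.
  exists (snd @^-1` N); split.
  - by rewrite -[X in measurable X]setTI; exact: measurable_snd.
  - by rewrite -N0; exact: (coupling_snd hpi).
  - move=> u /= hu; apply: sN => /=; apply: contra_notN hu => us2 _.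
    by rewrite /k /one atomic_funE us2 mul1r subrr mul0r addr0.
rewrite -(Rint_transfer (f := f : Rd R d -> R) measurable_fst (coupling_fst hpi))//.
rewrite -(Rint_transfer measurable_snd (coupling_snd hpi) (summable_atomic_fun _ _)).
rewrite -(RintD s1 s2); apply: (Rint_le sk s12) => u.
rewrite /k /one !atomic_funE; case: ifPn => us2.
  by rewrite mul1r subrr mul0r addr0; exact: fg.
by rewrite mul0r subr0 mul1r add0r.
Qed.

End finite_support.

Section backward.
Variables (R : realType) (d : nat) (mu nu : probability (Rd R d) R).
Hypotheses (hmu : P2 mu) (hnu : P2 nu).
Hypothesis W2_le : forall rho : probability (Rd R d) R, P2 rho ->
  (W2 nu rho ^+ 2 - W2 mu rho ^+ 2 <= moment2 nu - moment2 mu)%E.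

(** The Fenchel-Young inequality for f is an equality along (x, S x), whose law is
    the coupling pi of the proof, and holds along every coupling of nu and rho. *)
Lemma max_affine_le_of_W2 a b n :
  \int[mu]_x max_affine a b n x <= \int[nu]_y max_affine a b n y.
Proof.
have [j [mj jE]] := @max_affine_active R d a b n.
set f := max_affine a b n in jE *.
have sfm : summable_fun mu (f : Rd R d -> R) by exact: summable_max_affine.
have sfn : summable_fun nu (f : Rd R d -> R) by exact: summable_max_affine.
pose S (x : Rd R d) : Rd R d := a (j x).
have mS : measurable_fun setT S.
  exact: (measurable_cells mj (fun i : 'I_n.+1 => a i : Rd R d)).
pose S' : {mfun Rd R d >-> Rd R d} := HB.pack S (isMeasurableFun.Build _ _ _ _ S mS).
pose rho : probability (Rd R d) R := distribution mu S'.
have rhoE A : rho A = mu (S @^-1` A) by [].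
have mG : measurable_fun setT (fun x : Rd R d => (x, S x)).
  by apply: measurable_fun_pair => //; exact: measurable_id.
pose G' : {mfun Rd R d >-> (Rd R d * Rd R d)%type} :=
  HB.pack (fun x : Rd R d => (x, S x)) (isMeasurableFun.Build _ _ _ _ _ mG).
pose pi : probability (Rd R d * Rd R d)%type R := distribution mu G'.
have hpi : couplings mu rho pi by [].
have piE A : mu ((fun x : Rd R d => (x, S x)) @^-1` A) = pi A by [].
have muS A : measurable A -> mu (S @^-1` A) = rho A by [].
move: (rho) (pi) rhoE hpi piE muS => {}rho {}pi rhoE hpi piE muS.
have hrho : P2 rho.
  rewrite /P2 moment2_dotv.
  rewrite -(ge0_integral_transfer mS muS
    (f := fun x : Rd R d => (dotv (x : 'rV[R]_d) x)%:E)); last 2 first.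
  - by apply/measurable_EFinP; exact: measurable_dotv_self.
  - by move=> x; rewrite lee_fin; exact: dotv_ge0.
  rewrite -(@EFin_Rintegral _ _ _ mu (fun x => dotv (a (j x)) (a (j x)))) ?ltry//.
  exact: (summable_cells mu mj (fun i => dotv (a i) (a i))).
pose s := undup [seq a i | i : 'I_n.+1].
have us : uniq s by exact: undup_uniq.
have Ss x : S x \in s by rewrite mem_undup; apply/mapP; exists (j x); rewrite ?mem_enum.
have rho_s : rho.-negligible [set z : Rd R d | (z : 'rV[R]_d) \notin s].
  have ms : measurable [set z : Rd R d | (z : 'rV[R]_d) \notin s].
    rewrite (_ : [set _ | _] = atomic_fun s (fun=> 1) @^-1` [set 0]).
      rewrite -[X in measurable X]setTI.
      by apply: (summable_measurable (summable_atomic_fun s rho (fun=> 1))).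
    apply/seteqP; split => z /=; rewrite atomic_funE//.
      by move=> /negbTE ->.
    by case: ifP => // _ /eqP; rewrite oner_eq0.
  apply/negligibleP => //; apply: (etrans (rhoE _)).
  rewrite (_ : _ @^-1` _ = set0); first exact: measure0.
  by rewrite -subset0 => x /=; rewrite Ss.
(* The conjugate f^*; on a slope a_i it is at most - b_i. *)
pose g v := sup [set dotv y v - f y | y in [set: 'rV[R]_d]].
have gub (i : 'I_n.+1) : ubound [set dotv y (a i) - f y | y in [set: 'rV[R]_d]] (- b i).
  move=> _ [y _ <-]; have := @max_affine_ge R d a b n i y (ltnSE (ltn_ord i)).
  by rewrite -/f; lra.
have fg y v : v \in s -> dotv y v <= f y + g v.
  rewrite mem_undup => /mapP[i _ ->]; rewrite -lerBlDl.
  by apply: ub_le_sup; [exists (- b i); exact: gub|exists y].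
have gS x : g (S x) <= dotv (x : 'rV[R]_d) (S x) - f x.
  rewrite jE -/(S x) opprD addrA subrr add0r; apply: ge_sup; last exact: gub.
  by exists (dotv 0 (S x) - f 0), 0.
have sdS := summable_coupling_dotv hmu hrho hpi.
have sdS' : summable_fun mu (fun x => dotv (x : 'rV[R]_d) (S x)).
  apply: (summable_le (g := fun x : Rd R d =>
    dotv (x : 'rV[R]_d) x + dotv (S x : 'rV[R]_d) (S x))).
  - by apply: measurable_fun_dotv => //; exact: measurable_id.
  - by move=> x; exact: dotv_young.
  - apply: summableD; first exact: summable_dotv_self.
    exact: (summable_cells mu mj (fun i => dotv (a i) (a i))).
have piS : \int[pi]_u dotv (u.1 : 'rV[R]_d) u.2 = \int[mu]_x dotv (x : 'rV[R]_d) (S x).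
  by rewrite -(Rint_transfer mG (fun A _ => piE A) sdS).
have gint : \int[rho]_z atomic_fun s g z <=
    \int[mu]_x dotv (x : 'rV[R]_d) (S x) - \int[mu]_x f x.
  rewrite -(Rint_transfer mS muS (summable_atomic_fun _ _ _)) -RintB//.
  apply: Rint_le => [||x].
  - exact: (summable_transfer mS muS (summable_atomic_fun _ _ _)).
  - exact: summableB.
  - by rewrite atomic_funE// Ss.
have upper := W2_le hrho.
move: upper; rewrite leeBlDr; last exact: W2_sqr_fin_num.
move=> upper.
have {upper} : (W2 nu rho ^+ 2 <= (\int[nu]_y dotv (y : 'rV[R]_d) y +
    \int[rho]_x dotv (x : 'rV[R]_d) x - 2 * \int[mu]_x dotv (x : 'rV[R]_d) (S x))%:E)%E.
  apply: (le_trans upper).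
  apply: (@le_trans _ _ (moment2 nu - moment2 mu + transport_cost pi)%E).
    by apply: leeD => //; exact: W2_sqr_le.
  rewrite (transport_cost_Rintegral hmu hrho hpi) !moment2_Rintegral//.
  rewrite -EFinB -EFinD lee_fin (Rint_coupling_dotvB hmu hrho hpi) piS.
  by rewrite le_eqVlt; apply/orP; left; apply/eqP; ring.
(* If the integrals of f were in the wrong order, the dual bound on every
   coupling of nu and rho would exceed the upper bound on W2. *)
apply: contraTT; rewrite -!ltNge => flt.
rewrite W2_sqr; apply: (@lt_le_trans _ _ (\int[nu]_y dotv (y : 'rV[R]_d) y +
    \int[rho]_x dotv (x : 'rV[R]_d) x -
    2 * (\int[nu]_y f y + \int[rho]_z atomic_fun s g z))%:E).
  rewrite lte_fin ltrD2l ltrN2 ltr_pM2l//.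
  by move: flt gint; move: (\int[mu]_x f x) (\int[nu]_x f x) => A B; lra.
apply: le_ereal_inf_tmp => _ [pi' hpi' <-].
rewrite (transport_cost_Rintegral hnu hrho hpi') lee_fin (Rint_coupling_dotvB hnu hrho hpi').
rewrite lerD2l lerN2 ler_pM2l//.
exact: (fenchel_coupling us hnu hrho rho_s sfn fg hpi').
Qed.

End backward.

(** * Passage to general convex functions *)

Section monotone_limit.
Context d (T : measurableType d) (R : realType) (P : probability T R).
Variables (g l : T -> R).
Hypothesis mg : measurable_fun setT g.
Hypothesis sl : summable_fun P l.
Hypothesis lg : forall t, l t <= g t.

(** When the first integral on the right is infinite, the negative part of g is
    still controlled by l, so the left-hand side is infinite as well. *)
Lemma integral_split_minorant :
  (\int[P]_t (g t)%:E = \int[P]_t (g t - l t)%:E + \int[P]_t (l t)%:E)%E.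
Proof.
have mgl : measurable_fun setT (fun t => g t - l t).
  by apply: measurable_funB => //; exact: summable_measurable sl.
have gl0 t : 0 <= g t - l t by rewrite subr_ge0.
have [fin|] := ltP (\int[P]_t (g t - l t)%:E)%E +oo%E.
  have sgl := summable_ge0 mgl gl0 fin.
  rewrite -(EFin_Rintegral sgl) -(EFin_Rintegral sl) -EFinD -(RintD sgl sl).
  under eq_Rintegral do rewrite subrK.
  rewrite EFin_Rintegral//.
  by have := summableD sgl sl; under eq_fun do rewrite subrK.
rewrite leye_eq => /eqP infty.
rewrite infty -(EFin_Rintegral sl) addye//.
have mg' : measurable_fun setT (EFin \o g) by exact/measurable_EFinP.
have negfin : (\int[P]_t ((EFin \o g)^\- t) < +oo)%E.
  apply: (@le_lt_trans _ _ (\int[P]_t (`|l t|)%:E)%E).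
    apply: ge0_le_integral => //.
    - exact: measurable_funeneg.
    - by apply/measurable_EFinP; exact: summable_measurable (summable_norm sl).
    - move=> t _; rewrite funenegE/= -EFin_max lee_fin ge_max normr_ge0 andbT.
      by rewrite lerNl; apply: le_trans (lg t); have := ler_norm (- l t); rewrite normrN; lra.
  by rewrite -EFin_Rintegral ?ltry//; exact: summable_norm.
have posinf : (\int[P]_t ((EFin \o g)^\+ t) = +oo)%E.
  apply/eqP; rewrite -leye_eq -infty leNgt; apply/negP => lt.
  have spos : summable_fun P (fun t => Num.max (g t) 0).
    apply: summable_ge0.
    - by apply: measurable_maxr => //; exact: measurable_cst.
    - by move=> t; rewrite le_max lexx orbT.
    - apply: le_lt_trans (_ : _ <= \int[P]_t (EFin \o g)^\+ t)%E _ => //.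
        by under [leRHS]eq_integral do rewrite funeposE/= -EFin_max.
      by rewrite (lt_le_trans lt)// leey.
  have : summable_fun P (fun t => g t - l t).
    apply: (summable_le mgl (g := fun t => Num.max (g t) 0 + `|l t|)).
      move=> t; rewrite ger0_norm//; apply: lerD; first by rewrite le_max lexx.
      by rewrite -normrN ler_norm.
    by apply: summableD => //; exact: summable_norm.
  by move=> /EFin_Rintegral; rewrite infty.
rewrite integralE posinf addye//.
by apply/eqP => h; move: negfin; rewrite -[X in (X < _)%E]oppeK h ltxx.
Qed.

Variable g_ : nat -> T -> R.
Hypothesis sg_ : forall n, summable_fun P (g_ n).
Hypothesis lg_ : forall n t, l t <= g_ n t.
Hypothesis g_nd : forall t m n, (m <= n)%N -> g_ m t <= g_ n t.
Hypothesis g_cvg : forall t, g_ n t @[n --> \oo] --> g t.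

(** Monotone convergence for a sequence bounded below by an integrable
    function instead of 0. *)
Lemma integral_le_limit c : (forall n, (\int[P]_t (g_ n t)%:E <= c)%E) ->
  (\int[P]_t (g t)%:E <= c)%E.
Proof.
move=> hc.
have sgl n : summable_fun P (fun t => g_ n t - l t) by exact: summableB.
have cv : (\int[P]_t (g_ n t - l t)%:E @[n --> \oo] --> \int[P]_t (g t - l t)%:E)%E.
  rewrite (eq_integral (fun t => limn (fun n => (g_ n t - l t)%:E))); last first.
    move=> t _; apply/esym/cvg_lim => //; apply: cvg_EFin; first exact: nearW.
    by apply: cvgB; [exact: g_cvg|exact: cvg_cst].
  apply: cvg_monotone_convergence => //.
  - by move=> n; exact/measurable_EFinP/summable_measurable/sgl.
  - by move=> n t _; rewrite lee_fin subr_ge0.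
  - by move=> t _ m n mn; rewrite lee_fin lerB// g_nd.
rewrite integral_split_minorant -leeBrDr -?(EFin_Rintegral sl)//.
rewrite -(cvg_lim (@ereal_hausdorff R) cv); apply: lime_le; first by apply/cvg_ex; eexists; exact: cv.
apply: nearW => n; rewrite leeBrDr// EFin_Rintegral//.
have := hc n; rewrite -!EFin_Rintegral// RintB// -EFinD.
by rewrite subrK.
Qed.

End monotone_limit.

Section convex_limit.
Variables (R : realType) (d : nat).

Lemma max_affine_cvg (f : 'rV[R]_d -> R) a b x :
  (forall k x, dotv x (a k) + b k <= f x) ->
  (forall x (e : R), 0 < e -> exists k, f x - e < dotv x (a k) + b k) ->
  max_affine a b n x @[n --> \oo] --> f x.
Proof.
move=> le_f sup_f; apply/cvgrPdist_lt => e e0.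
have [k hk] := sup_f x e e0; near=> n.
have kn : (k <= n)%N by near: n; exact: nbhs_infty_ge.
have := max_affine_ge a b x kn.
have : max_affine a b n x <= f x by apply: max_affine_le => i _; exact: le_f.
by move=> h1 h2; rewrite ger0_norm; lra.
Unshelve. all: by end_near. Qed.

Lemma convex_order_of_W2 (mu nu : probability (Rd R d) R) : P2 mu -> P2 nu ->
  (forall rho : probability (Rd R d) R, P2 rho ->
    (W2 nu rho ^+ 2 - W2 mu rho ^+ 2 <= moment2 nu - moment2 mu)%E) ->
  convex_order mu nu.
Proof.
move=> hmu hnu hW f /convex_functionP cf.
have [a [b [le_f sup_f]]] := convex_countable_sup cf.
have cvf x := max_affine_cvg (x := x) le_f sup_f.
pose l : Rd R d -> R := max_affine a b 0.
have lf (x : Rd R d) : l x <= f x by exact: le_f.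
have sl (P : probability (Rd R d) R) : P2 P -> summable_fun P l.
  by move=> hP; exact: summable_max_affine.
have mf : measurable_fun setT (f : Rd R d -> R).
  apply: (@measurable_fun_cvg _ _ _ _ (fun n => max_affine a b n : Rd R d -> R)).
  - by move=> n; exact: measurable_max_affine.
  - by move=> x _; exact: cvf.
apply: (integral_le_limit mf (sl _ hmu) lf (g_ := fun n => max_affine a b n)).
- by move=> n; exact: summable_max_affine.
- by move=> n x; exact: max_affine_nondecreasing.
- by move=> x m n; exact: max_affine_nondecreasing.
- exact: cvf.
move=> n.
have sn (P : probability (Rd R d) R) : P2 P ->
    summable_fun P (max_affine a b n : Rd R d -> R).
  by move=> hP; exact: summable_max_affine.
apply: (@le_trans _ _ (\int[nu]_y (max_affine a b n y)%:E)%E).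
  by rewrite -!EFin_Rintegral ?lee_fin; [exact: max_affine_le_of_W2|exact: sn|exact: sn].
rewrite (integral_split_minorant mf (sl _ hnu) lf).
have mn : measurable_fun setT (max_affine a b n : Rd R d -> R).
  exact: measurable_max_affine.
have ln (x : Rd R d) : l x <= max_affine a b n x by exact: max_affine_nondecreasing.
have ml : measurable_fun setT l by exact: measurable_max_affine.
rewrite (integral_split_minorant mn (sl _ hnu) ln).
apply: leeD => //; apply: ge0_le_integral => //.
- by move=> x _; rewrite lee_fin subr_ge0.
- exact/measurable_EFinP/measurable_funB.
- exact/measurable_EFinP/measurable_funB.
- by move=> x _; rewrite lee_fin lerB//; apply: max_affine_le => k _; exact: le_f.
Qed.

End convex_limit.

Theorem theorem1 (R : realType) (d : nat) (hd : (1 <= d)%N)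
    (mu nu : probability (Rd R d) R) (hmu : P2 mu) (hnu : P2 nu) :
  convex_order mu nu <->
  (forall rho : probability (Rd R d) R, P2 rho ->
    (W2 nu rho ^+ 2 - W2 mu rho ^+ 2 <= moment2 nu - moment2 mu)%E).
Proof.
split=> [hc rho hrho|hW]; first exact: W2_le_of_convex_order.
exact: convex_order_of_W2.
Qed.
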